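(* Let $f$ be a TFPL with boundary $(u,v;w)$ whose excess $|\lambda(w)|-|\lambda(u)|-|\lambda(v)|$ equals $0$. Then $f$ is stable, i.e. $\mathrm{WL}(f)=f$.
   Context: The graph $G^N$ ($N\ge1$): the induced subgraph of the square grid made up of $N$ consecutive centered rows of $3,5,\dots,2N+1$ vertices from top to bottom, together with $2N+1$ vertical external edges hanging down from the $2N+1$ vertices of the bottom row (their lower endpoints are not counted as vertices). $\mathcal{L}^N=\{L_1,\dots,L_N\}$ (resp. $\mathcal{R}^N=\{R_1,\dots,R_N\}$) is the set of leftmost (resp. rightmost) vertices of the rows, numbered from left to right; so $L_1$ and $R_N$ lie in the bottom row, $L_N$ and $R_1$ in the top row. The cells of $G^N$ are its $N(N+1)$ unit squares, including the $2N$ external squares below the bottom row, each of which has only three surrounding edges (top, left, right). Cells are partitioned chessboard-wise into odd and even cells, the top left cell being odd. A TFPL (triangular fully packed loop configuration) of size $N$ is a subgraph $f$ of $G^N$ such that: (i) exactly every other external edge, starting with the second from the left, belongs to $f$; (ii) the vertices in $\mathcal{L}^N\cup\mathcal{R}^N$ have degree 0 or 1; (iii) all other vertices of $G^N$ have degree 2; (iv) no path in $f$ connects two vertices of $\mathcal{L}^N$ or two vertices of $\mathcal{R}^N$. The boundary of a TFPL $f$ of size $N$ is the triple $(u,v;w)$ of binary words (words in $\{0,1\}$) of length $N$ with: $u_i=1$ iff $L_i$ has degree 1; $v_i=1$ iff $R_i$ has degree 0; $w_i=1$ iff the $i$-th external edge in $f$ (from left to right) is connected by a path in $f$ either with a vertex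 in $\mathcal{L}^N$ or with an external edge to its left. For a binary word $\sigma$, $\lambda(\sigma)$ is the Young diagram associated with $\sigma$ and $|\lambda(\sigma)|$ its number of cells, which equals the number of inversions of $\sigma$, i.e. the number of pairs $i<j$ with $\sigma_i=1$ and $\sigma_j=0$. Wieland gyration of a cell: if the cell contains precisely two edges of the configuration and these lie on opposite sides, it is unchanged; otherwise edges and non-edges among its surrounding edges are exchanged. Left-Wieland gyration $\mathrm{WL}(f)$ of a TFPL $f$: (1) insert a vertex $L_i'$ to the left of $L_i$ for all $i$, and add a horizontal edge between $L'_i$ and $L_i$ for every $i$ such that $L_i$ has degree 1 in $f$; (2) apply Wieland gyration to each odd cell of $f$; (3) delete all vertices in $\mathcal{R}^N$ and their incident edges; finally shift everything one unit to the right. The result is a TFPL of size $N$. *)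

(* Defs.v *)
From mathcomp Require Import all_boot all_order all_algebra.
Set Implicit Arguments.
Unset Strict Implicit.
Unset Printing Implicit Defensive.

(* (row, column) pairs.  Rows are numbered 0, ..., N-1 from top to bottom, and
   row N holds the lower endpoints of the external edges.  The vertices of row
   r < N of G^N occupy the columns N-r, ..., N+r+2; column 0 is there only to
   accommodate the vertex that left-Wieland gyration inserts to the left of the
   leftmost vertex of the bottom row. *)
Definition point (N : nat) := ('I_N.+1 * 'I_N.*2.+2)%type.

(* Meaningful only for r <= N and c <= 2N+1, the range in which it is used. *)
Definition pt (N r c : nat) : point N := (inord r, inord c).

Definition vertices (N : nat) : {set point N} :=
  [set p : point N | [&& p.1 < N, N <= p.1 + p.2 & p.2 <= N + p.1 + 2]].

(* An edge is the pair of its endpoints, a configuration a set of edges. *)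
Definition edge (N : nat) := {set point N}.
Definition config (N : nat) := {set edge N}.

Definition hedge (N r c : nat) : edge N := [set pt N r c; pt N r c.+1].
Definition vedge (N r c : nat) : edge N := [set pt N r c; pt N r.+1 c].

(* External edges are numbered from 0, left to right. *)
Definition ext_edge (N : nat) (j : 'I_N.*2.+1) : edge N := vedge N N.-1 j.+1.

Definition grid_step (N : nat) (p q : point N) : bool :=
  (q.1 == p.1 :> nat) && (q.2 == p.2.+1 :> nat)
  || (q.1 == p.1.+1 :> nat) && (q.2 == p.2 :> nat).

Definition grid (N : nat) : config N :=
  [set [set p; q] | p in vertices N, q in vertices N & grid_step p q]
  :|: [set ext_edge j | j : 'I_N.*2.+1].

(* [leftv i] is L_(i+1) and [rightv i] is R_(i+1). *)
Definition leftv (N : nat) (i : 'I_N) : point N := pt N (N - i.+1) i.+1.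
Definition rightv (N : nat) (i : 'I_N) : point N := pt N i (N + i + 2).

Definition leftvs (N : nat) : {set point N} := [set leftv i | i : 'I_N].
Definition rightvs (N : nat) : {set point N} := [set rightv i | i : 'I_N].

Definition deg (N : nat) (f : config N) (p : point N) : nat :=
  #|[set e in f | p \in e]|.

Definition adj (N : nat) (f : config N) : rel (point N) :=
  fun p q => [set p; q] \in f.

Definition joined (N : nat) (f : config N) : rel (point N) := connect (adj f).

Definition TFPL (N : nat) (f : config N) : Prop :=
  [/\ f \subset grid N,
      forall j : 'I_N.*2.+1, (ext_edge j \in f) = odd j,
      forall p, p \in leftvs N :|: rightvs N -> deg f p <= 1,
      forall p, p \in vertices N :\: (leftvs N :|: rightvs N) -> deg f p = 2
    & forall i j : 'I_N, i != j ->
        ~~ joined f (leftv i) (leftv j) /\ ~~ joined f (rightv i) (rightv j)].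

(* The lower endpoint of the (i+1)-st external edge in a TFPL, i.e. of the
   external edge in column 2i+2. *)
Definition ext_end (N : nat) (i : 'I_N) : point N := pt N N i.*2.+2.

Definition boundary (N : nat) (f : config N) :
    N.-tuple bool * N.-tuple bool * N.-tuple bool :=
  ([tuple deg f (leftv i) == 1 | i < N],
   [tuple deg f (rightv i) == 0 | i < N],
   [tuple [exists j : 'I_N, joined f (ext_end i) (leftv j)]
       || [exists j : 'I_N, (j < i) && joined f (ext_end i) (ext_end j)]
     | i < N]).

(* The row lengths, top to bottom, of the diagram above the lattice path that
   starts at its lower left corner and steps right for each 1 and up for each
   0: each 0 contributes a row with one cell for every 1 before it. *)
Definition young (s : seq bool) : seq nat :=
  rev [seq count id (take j s) | j <- iota 0 (size s) & ~~ nth false s j].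

Definition young_size (s : seq bool) : nat := sumn (young s).

Lemma young_size_inversions (n : nat) (s : n.-tuple bool) :
  young_size s =
  #|[set p : 'I_n * 'I_n | [&& p.1 < p.2, tnth s p.1 & ~~ tnth s p.2]]|.
Proof.
rewrite /young_size /young sumn_rev sumnE big_map big_filter size_tuple.
have -> : iota 0 n = index_iota 0 n by rewrite /index_iota subn0.
rewrite big_mkord -sum1dep_card.
rewrite (eq_bigl (fun p : 'I_n * 'I_n =>
  xpredT p.1 && [&& p.1 < p.2, tnth s p.1 & ~~ tnth s p.2])) //.
rewrite -(pair_big_dep xpredT
  (fun i j : 'I_n => [&& i < j, tnth s i & ~~ tnth s j]) (fun _ _ => 1)) /=.
rewrite (exchange_big_dep (fun j => ~~ tnth s j)) /=; last first.
  by move=> i j _ /and3P[].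
apply: eq_big => [j | j sj]; first by rewrite (tnth_nth false).
rewrite -(map_nth_iota0 false); last by rewrite size_tuple ltnW.
rewrite count_map -sum1_count.
have -> : iota 0 j = index_iota 0 j by rewrite /index_iota subn0.
rewrite big_mkord (big_ord_widen_cond n (fun i => nth false s i) (fun _ => 1)).
  apply: eq_bigl => i; rewrite !(tnth_nth false) in sj *.
  by rewrite sj andbT andbC.
exact: ltnW.
Qed.

Definition excess (N : nat) (u v w : N.-tuple bool) : int :=
  ((young_size w)%:Z - (young_size u)%:Z - (young_size v)%:Z)%R.

(* A cell is given by its top left corner (r, c). *)
Definition is_cell (N r c : nat) : bool :=
  [&& r < N, N <= r + c & c <= N + r + 1].

(* The top left cell (0, N) is odd. *)
Definition odd_cell (N r c : nat) : bool :=
  is_cell N r c && (odd (r + c) == odd N).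

(* Intersecting with the grid removes the bottom side of the external cells. *)
Definition cell_edges (N r c : nat) : config N :=
  [set hedge N r c; hedge N r.+1 c; vedge N r c; vedge N r c.+1] :&: grid N.

Definition rigid (N : nat) (f : config N) (r c : nat) : bool :=
  (f :&: cell_edges N r c == [set hedge N r c; hedge N r.+1 c])
  || (f :&: cell_edges N r c == [set vedge N r c; vedge N r c.+1]).

(* Distinct odd cells have no edge in common, so that they can be gyrated
   simultaneously. *)
Definition gyrate_odd (N : nat) (f : config N) : config N :=
  [set e | (e \in f) (+)
     [exists r : 'I_N.+1, exists c : 'I_N.*2.+2,
       [&& odd_cell N r c, e \in cell_edges N r c & ~~ rigid f r c]]].

Definition insert_left (N : nat) (f : config N) : config N :=
  f :|: [set hedge N (N - i.+1) i | i : 'I_N & deg f (leftv i) == 1].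

Definition delete_right (N : nat) (f : config N) : config N :=
  [set e in f | [disjoint e & rightvs N]].

(* Never applied to a point of the last column: the edges there are incident to
   the rightmost vertex of the bottom row. *)
Definition shift_pt (N : nat) (p : point N) : point N := pt N p.1 p.2.+1.

Definition shift_right (N : nat) (f : config N) : config N :=
  [set [set shift_pt p | p in e] | e : edge N in f].

Definition WL (N : nat) (f : config N) : config N :=
  shift_right (delete_right (gyrate_odd (insert_left f))).

(* Main.v *)
(* Orient f canonically: away from the left vertices, towards the right ones,
   and from left to right between external edges, so that w_i = 1 iff the i-th
   external edge points down.  Call a vertex (r, c) odd if r + c = N mod 2; all
   left and right vertices are odd.  Colour an edge blue if it is oriented from
   its odd to its even endpoint, and red otherwise.  Blue edges then form a
   matching covering all vertices but the right ones and the left ones of degree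
   0, and red edges form a matching in the mirrored sense.

   Comparing the positions of the two ends of the blue edges shows that the
   number of blue edges going left or down from their odd endpoint is
   |lambda(w)| - |lambda(u)|; by mirroring, the number of red edges going right
   or down from their odd endpoint is |lambda(w)| - |lambda(v)|.  On the other
   hand, every inversion of w must be undone on the way up, row by row, and each
   crossing uses one of these blue left or red right edges, so that there are at
   least |lambda(w)| of them.  Hence the number of edges going down from an odd
   vertex is at most the excess.  If there is no such edge, the degree conditions
   determine the gyration of each odd cell, and it is the translation by one unit
   to the left. *)
Require Import Defs.
From mathcomp Require Import all_boot all_order all_algebra.
From mathcomp Require Import zify ring.
Set Implicit Arguments.
Unset Strict Implicit.
Unset Printing Implicit Defensive.

Import Order.TTheory GRing.Theory Num.Theory.

(** * Orientations of graphs of maximal degree two *)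

Section Orientation.
Variables (T : finType) (g : rel T).
Hypothesis gsym : symmetric g.
Hypothesis girr : irreflexive g.
Hypothesis gdeg2 : forall p q s t, g p q -> g p s -> g p t ->
  [|| q == s, q == t | s == t].

Definition dart_rev (d : T * T) : T * T := (d.2, d.1).

Definition dart_step : rel (T * T) := fun d e =>
  [&& g d.1 d.2, d.2 == e.1, g e.1 e.2 & d.1 != e.2].

(** For darts lying on edges of [g], the classes of this relation are the directions of travel along
    the paths and cycles of [g]. [dart_rev] exchanges the two directions, and an orientation chooses
    one of them. *)
Definition dart_link : rel (T * T) := fun d e => dart_step d e || dart_step e d.

Lemma dart_revK : involutive dart_rev. Proof. by case. Qed.

Lemma dart_step_rev d e : dart_step (dart_rev e) (dart_rev d) = dart_step d e.
Proof.
case: d e => p q [q' s]; rewrite /dart_step /dart_rev /= (gsym s) (gsym q p).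
by rewrite (eq_sym q') (eq_sym s); case: (g q' s); case: (g p q); rewrite ?andbF.
Qed.

Lemma dart_link_rev d e : dart_link (dart_rev d) (dart_rev e) = dart_link d e.
Proof. by rewrite /dart_link !dart_step_rev orbC. Qed.

Lemma dart_link_sym : connect_sym dart_link.
Proof. by apply: sym_connect_sym => d e; rewrite /dart_link orbC. Qed.

Lemma connect_dart_rev d e :
  connect dart_link (dart_rev d) (dart_rev e) = connect dart_link d e.
Proof.
suff imp x y : connect dart_link x y -> connect dart_link (dart_rev x) (dart_rev y).
  by apply/idP/idP => /imp //; rewrite !dart_revK.
case/connectP=> s; elim: s x => [|z s IH] x /=; first by move=> _ ->; apply: connect0.
case/andP=> xz zs y_last; apply: (connect_trans _ (IH z zs y_last)).
by apply: connect1; rewrite dart_link_rev.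
Qed.

Lemma dart_step_inj d d' e : dart_step d e -> dart_step d' e -> d = d'.
Proof.
case: d d' e => [p q] [p' q'] [s t] /and4P[/= pq /eqP qs st pt].
case/and4P=> /= p'q' /eqP q's _ p't; subst q q'.
move: pq p'q'; rewrite gsym (gsym p') => pq p'q'.
have := gdeg2 pq p'q' st; rewrite (negPf pt) (negPf p't) !orbF => /eqP->.
by [].
Qed.

Lemma dart_step_fun d e e' : dart_step d e -> dart_step d e' -> e = e'.
Proof.
rewrite -dart_step_rev -(dart_step_rev d) => h /(dart_step_inj h) eq_rev.
by rewrite -(dart_revK e) eq_rev dart_revK.
Qed.

Lemma connect_lastE (S : finType) (r : rel S) x y : connect r x y ->
  x = y \/ exists2 z, connect r x z & r z y.
Proof.
case/connectP=> s; elim/last_ind: s => [|s z _] /= ; first by left.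
rewrite rcons_path last_rcons => /andP[xs sz] ->; right; exists (last x s) => //.
by apply/connectP; exists s.
Qed.

Lemma connect_firstE (S : finType) (r : rel S) x y : connect r x y ->
  x = y \/ exists2 z, r x z & connect r z y.
Proof.
case/connectP=> [[|z s]] /=; first by left.
by case/andP=> xz zs ->; right; exists z => //; apply/connectP; exists s.
Qed.

(** Since steps are functional and injective, a change of direction in a chain of links retraces the
    previous step and can be cancelled. *)
Lemma connect_dart_linkE d e : connect dart_link d e ->
  connect dart_step d e \/ connect dart_step e d.
Proof.
case/connectP=> s; elim: s d => [|z s IH] d /=; first by move=> _ ->; left.
case/andP=> dz zs e_last; case/orP: dz => dz; case: (IH z zs e_last) => ze.
- by left; apply: connect_trans (connect1 dz) ze.
- case: (connect_lastE ze) => [->|[y ey yz]]; first by left; apply: connect1.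
  by right; rewrite (dart_step_inj dz yz).
- case: (connect_firstE ze) => [<-|[y zy ye]]; first by right; apply: connect1.
  by left; rewrite (dart_step_fun dz zy).
- by right; apply: connect_trans ze (connect1 dz).
Qed.

(* Dropping both ends of a path from d to its reverse gives a shorter such path. *)
Lemma dart_rev_unreachable d : g d.1 d.2 -> ~~ connect dart_step d (dart_rev d).
Proof.
move=> gd; apply/negP => /connectP[s].
have [n le_sn] := ubnP (size s); elim: n s d gd le_sn => // n IH s d gd.
case: s => [|e s] /= le_sn.
  by move=> _; case: d gd => p q /= + [pq]; rewrite pq girr.
case/andP=> de; elim/last_ind: s le_sn => [|s y _] le_sn /=.
  move=> _ e_def; move: de; rewrite -e_def => /and4P[_ _ _].
  by rewrite /= eqxx.
rewrite rcons_path last_rcons => /andP[es sy] y_def; subst y.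
have gz : g e.1 e.2 by case/and4P: de.
apply: (IH s e gz _ es).
  by move: le_sn; rewrite ltnS size_rcons => /ltnW.
by rewrite -(dart_step_rev d) in de; rewrite (dart_step_inj de sy).
Qed.

Lemma dart_rev_unlinked d : g d.1 d.2 -> ~~ connect dart_link d (dart_rev d).
Proof.
move=> gd; apply/negP => /connect_dart_linkE[].
  exact/negP/dart_rev_unreachable.
rewrite -{2}(dart_revK d); apply/negP/dart_rev_unreachable.
by rewrite /= gsym.
Qed.

(** A class containing a seed is chosen; between two opposite classes without seeds, the rank of the
    class representative decides. The hypothesis says that no class and its reverse both contain
    seeds. *)
Lemma orientation_of_seeds (S : pred (T * T)) :
  (forall d e, S d -> S e -> ~~ connect dart_link d (dart_rev e)) ->
  exists O : rel T,
    [/\ forall p q, g p q -> O q p = ~~ O p q,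
        forall p q s, g p q -> g q s -> p != s -> O p q = O q s
      & forall p q, S (p, q) -> O p q].
Proof.
move=> S_ok.
pose sd d := [exists s, S s && connect dart_link s d].
pose rk d := enum_rank (fingraph.root dart_link d).
pose O d := sd d || (~~ sd (dart_rev d) && (rk d < rk (dart_rev d))).
have sd_link d e : connect dart_link d e -> sd d = sd e.
  move=> de; apply: eq_existsb => s; congr (_ && _).
  by apply/idP/idP => h; apply: connect_trans h _ => //; rewrite dart_link_sym.
have rk_link d e : connect dart_link d e -> rk d = rk e.
  by move=> de; rewrite /rk; congr enum_rank; apply/(fingraph.rootP dart_link_sym).
have O_link d e : connect dart_link d e -> O d = O e.
  move=> de; rewrite /O (sd_link _ _ de) (rk_link _ _ de).
  move: de; rewrite -connect_dart_rev => de.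
  by rewrite (sd_link _ _ de) (rk_link _ _ de).
have sdN d : sd d -> sd (dart_rev d) -> False.
  case/existsP=> s /andP[Ss sd_d] /existsP[t /andP[St td]].
  apply/negP: (S_ok s t Ss St); rewrite negbK.
  apply: connect_trans sd_d _; rewrite -connect_dart_rev dart_revK.
  by rewrite dart_link_sym.
exists (fun p q => O (p, q)); split.
- move=> p q pq; have := dart_rev_unlinked (d := (p, q)) pq.
  rewrite -(root_connect dart_link_sym) => neq.
  have {}neq : rk (p, q) != rk (q, p).
    by apply: contra neq => /eqP/enum_rank_inj/eqP.
  rewrite /O /dart_rev /=; have := sdN (p, q); rewrite /dart_rev /=.
  case: (sd (p, q)); case: (sd (q, p)) => h //=; first by case: (h isT isT).
  by rewrite ltnNge leq_eqVlt (inj_eq val_inj) (negPf neq).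
- move=> p q s pq qs ps; apply/O_link/connect1/orP; left.
  by apply/and4P; split.
- move=> p q Spq; apply/orP; left; apply/existsP; exists (p, q).
  by rewrite Spq connect0.
Qed.

Definition endpoint (p : T) := forall q s, g p q -> g p s -> q = s.

Lemma no_step_into_endpoint d p q : endpoint p -> ~~ dart_step d (p, q).
Proof.
move=> ep; case: d => a b; apply/negP => /and4P[/= ab /eqP b_p pq].
by rewrite (ep a q) ?eqxx // -b_p gsym.
Qed.

Lemma endpoint_dart_uniq p q p' q' : endpoint p -> endpoint p' ->
  connect dart_link (p, q) (p', q') -> p = p'.
Proof.
move=> ep ep' /connect_dart_linkE[] /connect_lastE[[]//|[d _]];
by rewrite (negPf (no_step_into_endpoint _ _ _)).
Qed.

(** Simplicity of the path rules out backtracking, so consecutive edges are dart steps. *)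
Lemma path_dart_step s p q : path g p (q :: s) -> uniq (p :: q :: s) ->
  exists2 x, g x (last q s) & connect dart_step (p, q) (x, last q s).
Proof.
elim: s p q => [|t s IH] p q; first by rewrite /= andbT => pq _; exists p.
rewrite [path _ _ _]/= => /andP[pq qs] pu.
have [x gx cx] := IH q t qs (subseq_uniq (subseq_cons _ _) pu).
exists x => //; apply: connect_trans cx; apply: connect1.
case/andP: qs => qt _; apply/and4P; split => //=.
by move: pu; rewrite /= !inE !negb_or => /andP[/and3P[_ ->]].
Qed.

Lemma joined_endpoint_dart p p' : endpoint p' -> p != p' -> connect g p p' ->
  exists q q', [/\ g p q, g p' q' & connect dart_link (p, q) (q', p')].
Proof.
move=> ep' pp' /connectP[s ps p'_def].
move: pp'; rewrite p'_def; case/shortenP: ps p'_def => s' ps' us' _ p'_def.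
case: s' ps' us' p'_def => [|q s'] ps' us' p'_def /=; first by rewrite eqxx.
move=> _; have [x gx cx] := path_dart_step ps' us'.
exists q, x; split; [by case/andP: ps'|by rewrite gsym|].
apply: (connect_sub _ cx) => d e de; apply: connect1.
by rewrite /dart_link de.
Qed.

(** The darts entering [p'] and [p''] are both linked to the only dart leaving [p]. Their reverses
    are thus linked and leave endpoints, so [endpoint_dart_uniq] applies. *)
Lemma joined_endpoints_uniq p p' p'' : endpoint p -> endpoint p' ->
  endpoint p'' -> p != p' -> p != p'' -> connect g p p' -> connect g p p'' ->
  p' = p''.
Proof.
move=> ep ep' ep'' pp' pp''.
case/(joined_endpoint_dart ep' pp')=> q [q' [pq p'q' c']].
case/(joined_endpoint_dart ep'' pp'')=> t [q'' [pt p''q'' c'']].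
rewrite -(ep _ _ pq pt) in c''.
rewrite dart_link_sym in c'; have := connect_trans c' c''.
rewrite -connect_dart_rev; exact: endpoint_dart_uniq.
Qed.

Lemma linked_darts_joined d e : g d.1 d.2 -> connect dart_link d e ->
  connect g d.1 e.1.
Proof.
move=> gd /connectP[s]; elim: s d gd => [|z s IH] d gd /=; first by move=> _ ->.
case/andP=> dz zs e_last.
have gz : g z.1 z.2 by case/orP: dz => /and4P[].
apply: (connect_trans _ (IH z gz zs e_last)).
case/orP: dz => /and4P[a /eqP b c _]; first by rewrite -b connect1.
by rewrite -b connect1 // gsym.
Qed.

(** The seeds are the darts leaving a point of [B] with positive sign or entering one with negative
    sign. *)
Theorem orientation_with_signs (B : {pred T}) (sg : pred T) :
  (forall p, p \in B -> endpoint p) ->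
  (forall p p', p \in B -> p' \in B -> p != p' -> connect g p p' ->
     sg p != sg p') ->
  exists O : rel T,
    [/\ forall p q, g p q -> O q p = ~~ O p q,
        forall p q s, g p q -> g q s -> p != s -> O p q = O q s
      & forall p q, p \in B -> g p q -> O p q = sg p].
Proof.
move=> epB sgB.
pose S (d : T * T) := g d.1 d.2 &&
  ((d.1 \in B) && sg d.1 || (d.2 \in B) && ~~ sg d.2).
(* The two points are the ends of one path. They are distinct, since otherwise a dart would be
   linked to its own reverse. *)
have clash p q p' q' : g p q -> p \in B -> p' \in B -> g p' q' ->
    connect dart_link (p, q) (q', p') -> sg p != sg p'.
  move=> pq pB p'B p'q' c; apply: sgB => //.
    apply/eqP=> pp'; subst p'; move: c; rewrite (epB p pB _ _ p'q' pq).
    by apply/negP; apply: (@dart_rev_unlinked (p, q)).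
  have /= := linked_darts_joined (d := (p, q)) pq c => c1.
  by apply: connect_trans c1 (connect1 _); rewrite gsym.
have [|O [O1 O2 O3]] := @orientation_of_seeds S.
  move=> [p q] [p' q'] /andP[/= pq Sd] /andP[/= p'q' Se]; apply/negP => c.
  rewrite /dart_rev /= in c.
  case/orP: Sd => /andP[dB sd]; case/orP: Se => /andP[eB se].
  - by have := clash _ _ _ _ pq dB eB p'q' c; rewrite sd se.
  - have e := endpoint_dart_uniq (epB _ dB) (epB _ eB) c.
    by move: se; rewrite -e sd.
  - move: c; rewrite -connect_dart_rev /dart_rev /= => c.
    have e := endpoint_dart_uniq (epB _ dB) (epB _ eB) c.
    by move: sd; rewrite e se.
  - move: c; rewrite -connect_dart_rev /dart_rev /= => c.
    rewrite gsym in pq; rewrite gsym in p'q'.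
    by have := clash _ _ _ _ pq dB eB p'q' c; rewrite (negPf sd) (negPf se).
exists O; split=> // p q pB pq; case sgp: (sg p).
  by apply: O3; rewrite /S /= pq pB sgp.
apply/negbTE; rewrite -O1 //; apply: O3.
by rewrite /S /= gsym pq pB sgp orbT.
Qed.
End Orientation.

(** * The triangular grid *)

Lemma set2_eq (T : finType) (a b p q : T) : [set p; q] = [set a; b] ->
  p = a /\ q = b \/ p = b /\ q = a.
Proof.
move=> e.
have := set21 p q; have := set22 p q; rewrite e !inE.
have := set21 a b; have := set22 a b; rewrite -e !inE.
by do 4![case/orP=> /eqP ?]; subst; auto.
Qed.

Section Grid.
Variable N : nat.
Implicit Types (r c : nat) (g : config N) (p q : point N).

Lemma pt_row r c : r <= N -> (pt N r c).1 = r :> nat.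
Proof. by move=> rN; rewrite inordK. Qed.

Lemma pt_col r c : c <= N.*2.+1 -> (pt N r c).2 = c :> nat.
Proof. by move=> cN; rewrite inordK. Qed.

Lemma pt_coord p : pt N p.1 p.2 = p.
Proof. by case: p => a b; rewrite /pt !inord_val. Qed.

Lemma pt_eq r c r' c' : r <= N -> c <= N.*2.+1 -> r' <= N -> c' <= N.*2.+1 ->
  (pt N r c == pt N r' c') = (r == r') && (c == c').
Proof.
move=> rN cN r'N c'N; apply/eqP/andP => [e|[/eqP-> /eqP->] //].
by split; apply/eqP; [rewrite -(pt_row c rN) e pt_row | rewrite -(pt_col r cN) e pt_col].
Qed.

Lemma hedge_inj r c r' c' : r <= N -> c <= N.*2 -> r' <= N -> c' <= N.*2 ->
  hedge N r c = hedge N r' c' -> r = r' /\ c = c'.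
Proof.
move=> rN cN r'N c'N /set2_eq[] [/eqP + /eqP]; rewrite !pt_eq; lia.
Qed.

Lemma vedge_inj r c r' c' : r < N -> c <= N.*2.+1 -> r' < N -> c' <= N.*2.+1 ->
  vedge N r c = vedge N r' c' -> r = r' /\ c = c'.
Proof.
move=> rN cN r'N c'N /set2_eq[] [/eqP + /eqP]; rewrite !pt_eq; lia.
Qed.

Lemma hedge_vedge r c r' c' : r <= N -> c <= N.*2 -> r' < N -> c' <= N.*2.+1 ->
  hedge N r c <> vedge N r' c'.
Proof.
move=> rN cN r'N c'N /set2_eq[] [/eqP + /eqP]; rewrite !pt_eq; lia.
Qed.

Lemma grid_step_pt r c r' c' :
  r <= N -> c <= N.*2.+1 -> r' <= N -> c' <= N.*2.+1 ->
  grid_step (pt N r c) (pt N r' c')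
  = (r' == r) && (c' == c.+1) || (r' == r.+1) && (c' == c).
Proof.
move=> rN cN r'N c'N; rewrite /grid_step (pt_row c rN) (pt_row c' r'N).
by rewrite (pt_col r cN) (pt_col r' c'N).
Qed.

Lemma mem_vertices r c : r < N -> c <= N.*2.+1 ->
  (pt N r c \in vertices N) = (N <= r + c) && (c <= N + r + 2).
Proof. by move=> rN cN; rewrite inE pt_row ?pt_col ?rN //; apply: ltnW. Qed.

Lemma hedge_grid r c : r < N -> N <= r + c -> c <= N + r + 1 ->
  hedge N r c \in grid N.
Proof.
move=> rN Nc cN; rewrite inE; apply/orP; left.
apply/imset2P; exists (pt N r c) (pt N r c.+1) => //.
  by rewrite mem_vertices; lia.
rewrite inE mem_vertices; [|lia|lia].
apply/andP; split; first lia.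
rewrite grid_step_pt; lia.
Qed.

Lemma vedge_grid r c : r < N -> N <= r + c -> c <= N + r + 2 ->
  vedge N r c \in grid N.
Proof.
move=> rN Nc cN; rewrite inE; apply/orP.
have [r1N|Nr1] := ltnP r.+1 N; [left|right].
  apply/imset2P; exists (pt N r c) (pt N r.+1 c) => //.
    by rewrite mem_vertices; lia.
  rewrite inE mem_vertices; [|lia|lia].
  apply/andP; split; first lia.
  rewrite grid_step_pt; lia.
have c0 : c.-1 < N.*2.+1 by lia.
apply/imsetP; exists (Ordinal c0) => //; rewrite /ext_edge /=.
by congr (vedge N _ _); lia.
Qed.

Hypothesis hN : 0 < N.

Lemma gridP e : e \in grid N ->
  (exists r c, [/\ r < N, N <= r + c, c <= N + r + 1 & e = hedge N r c]) \/
  (exists r c, [/\ r < N, N <= r + c, c <= N + r + 2 & e = vedge N r c]).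
Proof.
rewrite inE => /orP[/imset2P[p q]|/imsetP[j _ ->]]; last first.
  case: j => j jN; right; exists N.-1, j.+1; split => //=; lia.
rewrite !inE => /and3P[p1 p2 p3] /andP[/and3P[q1 q2 q3] pq] ->.
rewrite -(pt_coord p) -(pt_coord q).
move: p1 p2 p3 q3 pq; rewrite /grid_step.
move: (nat_of_ord p.1) (nat_of_ord p.2) (nat_of_ord q.1) (nat_of_ord q.2).
move=> r c r' c' rN Nc cN cN' /orP[] /andP[/eqP e1 /eqP e2]; subst r' c';
  [left|right]; exists r, c; split=> //; lia.
Qed.

Lemma hedge_in_grid r c : r <= N -> c <= N.*2 -> hedge N r c \in grid N ->
  [/\ r < N, N <= r + c & c <= N + r + 1].
Proof.
move=> rN cN /gridP[] [r' [c' [a b d]]].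
  by case/hedge_inj=> //; [lia|lia|move=> -> ->].
by move/hedge_vedge; case=> //; lia.
Qed.

Lemma vedge_in_grid r c : r < N -> c <= N.*2.+1 -> vedge N r c \in grid N ->
  N <= r + c /\ c <= N + r + 2.
Proof.
move=> rN cN /gridP[] [r' [c' [a b d]]].
  by move/esym/hedge_vedge; case=> //; lia.
by case/vedge_inj=> //; [lia|move=> -> ->].
Qed.

Lemma mem_hedge r c r' c' : r <= N -> c <= N.*2.+1 -> r' <= N -> c' <= N.*2 ->
  (pt N r c \in hedge N r' c') = (r == r') && ((c == c') || (c == c'.+1)).
Proof. by move=> *; rewrite !inE !pt_eq; lia. Qed.

Lemma mem_vedge r c r' c' : r <= N -> c <= N.*2.+1 -> r' < N -> c' <= N.*2.+1 ->
  (pt N r c \in vedge N r' c') = (c == c') && ((r == r') || (r == r'.+1)).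
Proof. by move=> *; rewrite !inE !pt_eq; lia. Qed.

Lemma deg_pt g r c : g \subset grid N -> r < N -> N <= r + c -> c <= N + r + 2 ->
  deg g (pt N r c) = (hedge N r c.-1 \in g)
    + ((c <= N + r + 1) && (hedge N r c \in g))
    + ((0 < r) && (vedge N r.-1 c \in g)) + (vedge N r c \in g).
Proof.
move=> gG rN Nc cN.
(* The guards drop the edge to the right of a rightmost vertex, whose far end may exceed the range
   of [inord], and the edge above row 0, where [r.-1] would name the lower edge again. *)
pose s := [:: hedge N r c.-1] ++ (if c <= N + r + 1 then [:: hedge N r c] else [::])
  ++ (if 0 < r then [:: vedge N r.-1 c] else [::]) ++ [:: vedge N r c].
have us : uniq s.
  rewrite /s; case: ifP => c1; case: ifP => r0; rewrite /= ?inE ?negb_or ?andbT;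
  repeat (apply/andP; split); apply/eqP;
  by [case/hedge_inj; lia | case/vedge_inj; lia | move/hedge_vedge; apply; lia].
have -> : deg g (pt N r c) = size (filter (mem g) s).
  rewrite /deg -(card_uniqP _) ?filter_uniq //; apply: eq_card => e.
  rewrite !inE mem_filter /= andbC; case eg: (e \in g); rewrite ?andbF //= ?andbT.
  have eG := gridP (subsetP gG _ eg).
  apply/idP/idP.
    case: eG => [] [r' [c' [a b d ->]]].
      rewrite mem_hedge; [|lia..]; case/andP=> /eqP rr /orP[] /eqP cc; subst r'.
        by rewrite /s -cc !mem_cat; case: ifP; [rewrite !inE eqxx ?orbT|lia].
      by rewrite /s mem_cat mem_seq1 cc /= eqxx.
    rewrite mem_vedge; [|lia..]; case/andP=> /eqP cc /orP[] /eqP rr; subst c'.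
      by rewrite /s !mem_cat -rr !inE eqxx !orbT.
    by rewrite /s !mem_cat rr /= !inE eqxx !orbT.
  rewrite /s !mem_cat !inE => /or4P[/eqP->| | |/eqP->].
  - by rewrite mem_hedge; lia.
  - by case: ifP => // h; rewrite inE => /eqP->; rewrite mem_hedge; lia.
  - by case: ifP => // h; rewrite inE => /eqP->; rewrite mem_vedge; lia.
  - by rewrite mem_vedge; lia.
rewrite size_filter /s !count_cat /=.
by case: ifP => _; case: ifP => _; rewrite /=; lia.
Qed.
End Grid.

(** * Stability *)

Section Stability.
Variables (N : nat) (hN : 0 < N).
Implicit Types (r c : nat) (g f : config N).

Lemma mem_leftvs r c : r <= N -> c <= N.*2.+1 ->
  (pt N r c \in leftvs N) = [&& r < N & r + c == N].
Proof.
move=> rN cN; apply/imsetP/andP => [[[i iN] _ /eqP]|[rlt /eqP rc]].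
  by rewrite /leftv pt_eq /=; lia.
have c1 : c.-1 < N by lia.
by exists (Ordinal c1) => //; apply/eqP; rewrite /leftv pt_eq /=; lia.
Qed.

Lemma mem_rightvs r c : r <= N -> c <= N.*2.+1 ->
  (pt N r c \in rightvs N) = [&& r < N & c == N + r + 2].
Proof.
move=> rN cN; apply/imsetP/andP => [[[i iN] _ /eqP]|[rlt /eqP rc]].
  by rewrite /rightv pt_eq /=; lia.
by exists (Ordinal rlt) => //; apply/eqP; rewrite /rightv pt_eq /=; lia.
Qed.

Lemma mem_interior r c : r < N -> N < r + c -> c < N + r + 2 ->
  pt N r c \in vertices N :\: (leftvs N :|: rightvs N).
Proof.
move=> rN Nc cN; rewrite in_setD in_setU mem_leftvs ?mem_rightvs ?mem_vertices; lia.
Qed.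

Lemma mem_cell_edges r c e : is_cell N r c -> e \in cell_edges N r c ->
  [\/ e = hedge N r c, r.+1 < N /\ e = hedge N r.+1 c, e = vedge N r c
    | e = vedge N r c.+1].
Proof.
move=> /and3P[rN Nc cN]; rewrite inE => /andP[e_in eG]; move: e_in.
rewrite !inE -!orbA => /or4P[] /eqP e_def; rewrite e_def in eG *;
  [by constructor 1 | | by constructor 3 | by constructor 4].
by constructor 2; split=> //; case/hedge_in_grid: eG => //; lia.
Qed.

(** Two different cells sharing an edge are neighbours, hence of opposite parity. *)
Lemma odd_cell_uniq r c r' c' e : odd_cell N r c -> odd_cell N r' c' ->
  e \in cell_edges N r c -> e \in cell_edges N r' c' -> r = r' /\ c = c'.
Proof.
move=> /andP[cl /eqP od] /andP[cl' /eqP od'].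
case/(mem_cell_edges cl)=> [->|[rN ->]|->|->];
case/(mem_cell_edges cl')=> [|[rN']||] E;
case/and3P: cl => *; case/and3P: cl' => *;
by first [case: (hedge_inj _ _ _ _ E); lia | case: (vedge_inj _ _ _ _ E); lia
  | exfalso; apply: (hedge_vedge _ _ _ _ E); lia
  | exfalso; apply: (hedge_vedge _ _ _ _ (esym E)); lia].
Qed.

Lemma mem_gyrate_odd g r c e : odd_cell N r c -> e \in cell_edges N r c ->
  (e \in gyrate_odd g) = (e \in g) (+) ~~ rigid g r c.
Proof.
move=> od er; rewrite inE; congr (_ (+) _).
apply/existsP/idP => [[r' /existsP[c' /and3P[od' er' rig]]]|rig].
  by case: (odd_cell_uniq od od' er er') => -> ->.
case/andP: (od) => /and3P[rN Nc cN] _.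
have rb : r < N.+1 by lia.
have cb : c < N.*2.+2 by lia.
by exists (Ordinal rb); apply/existsP; exists (Ordinal cb); apply/and3P.
Qed.

Lemma gyrate_odd_off_grid g e : e \notin grid N ->
  (e \in gyrate_odd g) = (e \in g).
Proof.
move=> eG; rewrite inE; case: existsP => [[r /existsP[c /and3P[_]]]|_].
  by rewrite inE (negPf eG) andbF.
by rewrite addbF.
Qed.

Lemma shift_hedge r c : r <= N -> c <= N.*2 ->
  [set shift_pt p | p in hedge N r c] = hedge N r c.+1.
Proof.
by move=> rN cN; rewrite imsetU !imset_set1 /shift_pt !pt_row ?pt_col //; lia.
Qed.

Lemma shift_vedge r c : r < N -> c <= N.*2.+1 ->
  [set shift_pt p | p in vedge N r c] = vedge N r c.+1.
Proof.
by move=> rN cN; rewrite imsetU !imset_set1 /shift_pt !pt_row ?pt_col //; lia.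
Qed.

Lemma hedge_disjoint_right r c : r < N -> c <= N.*2 ->
  [disjoint hedge N r c & rightvs N] = (c != N + r + 2) && (c != N + r + 1).
Proof.
move=> rN cN; rewrite /hedge -setI_eq0 setIUl setU_eq0 !setI_eq0 !disjoints1.
rewrite !mem_rightvs; lia.
Qed.

Lemma vedge_disjoint_right r c : r < N -> N <= r + c -> c <= N + r + 2 ->
  [disjoint vedge N r c & rightvs N] = (c != N + r + 2).
Proof.
move=> rN Nc cN; rewrite /vedge -setI_eq0 setIUl setU_eq0 !setI_eq0 !disjoints1.
rewrite !mem_rightvs; lia.
Qed.

Variable f : config N.
Hypothesis hf : TFPL f.

Let fG : f \subset grid N. Proof. by case: hf. Qed.

Hypothesis no_top : forall r c, r < N -> N <= r + c -> c <= N + r + 2 ->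
  odd (r + c) = odd N -> vedge N r c \notin f.

Let g := insert_left f.

Lemma insert_left_grid e : e \in grid N -> (e \in g) = (e \in f).
Proof.
move=> eG; rewrite inE orb_idr // => /imsetP[[i iN] _ e_def]; move: eG.
rewrite e_def => /(hedge_in_grid hN)[] /=; lia.
Qed.

Lemma insert_left_cell r c : g :&: cell_edges N r c = f :&: cell_edges N r c.
Proof.
apply/setP => e; rewrite !in_setI; case eG: (e \in grid N); last by rewrite !andbF.
by rewrite insert_left_grid.
Qed.

Section Cell.
Variables (r c : nat).
Hypotheses (rN : r < N) (Nc : N <= r + c) (cN : c <= N + r).
Hypothesis rc_odd : odd (r + c) = odd N.

(** This is the degree condition at the top right corner, an even vertex: the edge above it goes
    down from an odd vertex and is absent. *)
Lemma right_side_deg : (hedge N r c \in f) + (hedge N r c.+1 \in f)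
  + (vedge N r c.+1 \in f) = 2.
Proof.
have [_ _ _ d2 _] := hf.
have := d2 (pt N r c.+1) (mem_interior _ _ _); rewrite (deg_pt hN fG) /=; try lia.
have -> : (c.+1 <= N + r + 1) by lia.
suff -> : (0 < r) && (vedge N r.-1 c.+1 \in f) = false by lia.
apply/negP => /andP[r0 vf].
have [] := vedge_in_grid hN _ _ (subsetP fG _ vf); try lia.
by move=> h1 h2; apply/negP: vf; apply: no_top; lia.
Qed.

(** This is the degree condition at the bottom right corner, an odd vertex, below which there is no
    edge. *)
Lemma bottom_side_deg : r.+1 < N -> (hedge N r.+1 c \in f)
  + (hedge N r.+1 c.+1 \in f) + (vedge N r c.+1 \in f) = 2.
Proof.
move=> r1N; have [_ _ _ d2 _] := hf.
have := d2 (pt N r.+1 c.+1) (mem_interior _ _ _); rewrite (deg_pt hN fG) /=; try lia.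
have -> : (c.+1 <= N + r.+1 + 1) by lia.
suff -> : (vedge N r.+1 c.+1 \in f) = false by rewrite /=; lia.
by apply/negbTE/no_top; lia.
Qed.

Lemma cell_left : vedge N r c \notin f.
Proof. by apply: no_top; lia. Qed.

(** In the bottom row the right side of an odd cell is one of the external edges that belong to
    [f]. *)
Lemma cell_interior : vedge N r c.+1 \notin f -> r.+1 < N.
Proof.
move=> vf; rewrite ltnNge; apply: contra vf => Nr.
have [_ ext _ _ _] := hf.
have cb : c < N.*2.+1 by lia.
have rE : r = N.-1 by lia.
by have := ext (Ordinal cb); rewrite /ext_edge /= rE => ->; lia.
Qed.

Lemma hedge_cell : hedge N r c \in cell_edges N r c.
Proof. by rewrite in_setI hedge_grid ?andbT ?inE ?eqxx //; lia. Qed.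

Lemma hedge_bottom_cell : r.+1 < N -> hedge N r.+1 c \in cell_edges N r c.
Proof. by move=> r1N; rewrite in_setI hedge_grid ?andbT ?inE ?eqxx ?orbT //; lia. Qed.

Lemma vedge_left_cell : vedge N r c \in cell_edges N r c.
Proof. by rewrite in_setI vedge_grid ?andbT ?inE ?eqxx ?orbT //; lia. Qed.

Lemma vedge_right_cell : vedge N r c.+1 \in cell_edges N r c.
Proof. by rewrite in_setI vedge_grid ?andbT ?inE ?eqxx ?orbT //; lia. Qed.

Lemma odd_cell_rc : odd_cell N r c.
Proof. by rewrite /odd_cell /is_cell; lia. Qed.

(** The left side is never present. If the right side is absent too, the two degree conditions force
    both horizontal sides; if it is present, neither pair of opposite sides is exactly what the cell
    contains. *)
Lemma rigid_cell : rigid g r c = (vedge N r c.+1 \notin f).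
Proof.
rewrite /rigid insert_left_cell; apply/idP/idP => [|vf].
  apply: contraL => vf; rewrite negb_or; apply/andP; split.
    apply/eqP=> /setP/(_ (vedge N r c.+1)).
    rewrite in_setI vf vedge_right_cell !inE => /esym/orP[] /eqP /esym;
    by apply: hedge_vedge; lia.
  apply/eqP=> /setP/(_ (vedge N r c)).
  by rewrite in_setI (negPf cell_left) !inE eqxx.
have r1N := cell_interior vf.
have := right_side_deg; have := bottom_side_deg r1N; rewrite (negPf vf) => B T.
apply/orP; left; apply/eqP/setP => e; rewrite [LHS]in_setI [RHS]in_set2.
apply/andP/idP => [[ef ec]|].
  have cl : is_cell N r c by case/andP: odd_cell_rc.
  case/(mem_cell_edges cl): ec ef => [->|[_ ->]|->|->]; rewrite ?eqxx ?orbT //.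
    by rewrite (negPf cell_left).
  by rewrite (negPf vf).
case/orP=> /eqP->; split; rewrite ?hedge_cell ?hedge_bottom_cell //; lia.
Qed.

Lemma gyrate_cell e : e \in cell_edges N r c ->
  (e \in gyrate_odd g) = (e \in f) (+) (vedge N r c.+1 \in f).
Proof.
move=> ec; rewrite (mem_gyrate_odd _ odd_cell_rc ec) rigid_cell negbK.
by rewrite insert_left_grid //; move: ec; rewrite inE => /andP[].
Qed.
End Cell.

(** The edge is an inserted one, the top side of an odd cell, or the bottom side of the odd cell
    above. In a cell with right side present, exactly one of the edge and its right neighbour is in
    [f], so complementing translates; in a rigid cell both are in [f]. *)
Lemma gyrate_hedge r c : r < N -> N <= (r + c).+1 -> c <= N + r ->
  (hedge N r c \in gyrate_odd g) = (hedge N r c.+1 \in f).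
Proof.
move=> rN Nc cN; have [Nrc|rcN] := leqP N (r + c); last first.
  have hG : hedge N r c \notin grid N.
    by apply/negP => /(hedge_in_grid hN)[]; lia.
  rewrite gyrate_odd_off_grid // inE.
  have -> : (hedge N r c \in f) = false.
    by apply/negbTE; apply: contra hG => /(subsetP fG).
  (* For an inserted edge, the leftmost vertex next to it has no vertical edge, so its degree is the
     bit of the horizontal edge to its right. *)
  have cN' : c < N by lia.
  have degL : deg f (leftv (Ordinal cN')) = (hedge N r c.+1 \in f).
    have -> : leftv (Ordinal cN') = pt N r c.+1.
      by apply/eqP; rewrite /leftv /= pt_eq; lia.
    rewrite (deg_pt hN fG) /=; try lia.
    have -> : (hedge N r c \in f) = false.
      by apply/negbTE; apply: contra hG => /(subsetP fG).
    have -> : (vedge N r c.+1 \in f) = false by apply/negbTE/no_top; lia.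
    have -> : (0 < r) && (vedge N r.-1 c.+1 \in f) = false.
      apply/negP => /andP[r0 vf].
      by have [] := vedge_in_grid hN _ _ (subsetP fG _ vf); lia.
    have -> : c.+1 <= N + r + 1 by lia.
    by rewrite addn0 addn0.
  apply/imsetP/idP => [[[i iN]]|hf1].
    rewrite inE => /eqP di hE.
    have [] := hedge_inj _ _ _ _ hE; rewrite /=; try lia.
    move=> _ ci; suff iE : Ordinal iN = Ordinal cN'.
      by rewrite iE degL in di; case: (_ \in _) di.
    exact/val_inj.
  exists (Ordinal cN'); first by rewrite inE degL hf1.
  by congr (hedge N _ _) => /=; lia.
have [rc_odd|rc_even] := eqVneq (odd (r + c)) (odd N).
  rewrite (gyrate_cell rN Nrc cN rc_odd (hedge_cell rN Nrc cN rc_odd)).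
  have := right_side_deg rN Nrc cN rc_odd.
  by case: (_ \in f); case: (_ \in f); case: (_ \in f).
case: r rN Nc cN Nrc rc_even => [|r] rN Nc cN Nrc rc_even; first by exfalso; lia.
have h1 : r < N by lia.
have h2 : N <= r + c by lia.
have h3 : c <= N + r by lia.
have h4 : odd (r + c) = odd N by lia.
rewrite (gyrate_cell h1 h2 h3 h4 (hedge_bottom_cell h1 h2 h3 h4 rN)).
have := bottom_side_deg h1 h2 h3 h4 rN.
by case: (_ \in f); case: (_ \in f); case: (_ \in f).
Qed.

Lemma gyrate_vedge r c : r < N -> N <= r + c -> c <= N + r + 1 ->
  (vedge N r c \in gyrate_odd g) = (vedge N r c.+1 \in f).
Proof.
move=> rN Nc cN; have [rc_odd|rc_even] := eqVneq (odd (r + c)) (odd N).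
  have h3 : c <= N + r by lia.
  rewrite (gyrate_cell rN Nc h3 rc_odd (vedge_left_cell rN Nc h3 rc_odd)).
  by rewrite (negPf (cell_left rN Nc h3 rc_odd)).
case: c Nc cN rc_even => [|c] Nc cN rc_even; first by exfalso; lia.
have h2 : N <= r + c by lia.
have h3 : c <= N + r by lia.
have h4 : odd (r + c) = odd N by lia.
rewrite (gyrate_cell rN h2 h3 h4 (vedge_right_cell rN h2 h3 h4)) addbb.
by apply/esym/negbTE/no_top; lia.
Qed.

(** By [gyrate_hedge] and [gyrate_vedge], gyration moves the configuration one unit to the left,
    which the final shift undoes. *)
Theorem no_odd_top_stable : WL f = f.
Proof.
apply/eqP; rewrite eqEsubset; apply/andP; split; apply/subsetP => e.
  case/imsetP=> e'; rewrite inE => /andP[eg dis] ->.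
  have : e' \in grid N \/ exists2 i : 'I_N, deg f (leftv i) == 1 &
      e' = hedge N (N - i.+1) i.
    case eG : (e' \in grid N); [by left|right].
    move: eg; rewrite gyrate_odd_off_grid ?eG // inE.
    case/orP=> [/(subsetP fG)|/imsetP[i]]; first by rewrite eG.
    by rewrite inE => di e_def; exists i.
  case=> [/(gridP hN)[] [r [c [rN Nc cN e_def]]]|[[i iN] _ e_def]].
  - move: eg dis; rewrite e_def shift_hedge; try lia.
    rewrite hedge_disjoint_right; try lia.
    by move=> eg /andP[c2 c1]; rewrite -gyrate_hedge //; lia.
  - move: eg dis; rewrite e_def shift_vedge; try lia.
    rewrite vedge_disjoint_right; try lia.
    by move=> eg c1; rewrite -gyrate_vedge //; lia.
  - move: eg; rewrite e_def shift_hedge /=; try lia.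
    by rewrite gyrate_hedge //; lia.
move=> ef; case/(gridP hN): (subsetP fG _ ef) => [] [r [c [rN Nc cN e_def]]].
  case: c Nc cN e_def => [|c] Nc cN e_def; first by exfalso; lia.
  apply/imsetP; exists (hedge N r c); last by rewrite e_def shift_hedge //; lia.
  rewrite inE gyrate_hedge; try lia.
  by rewrite -e_def ef hedge_disjoint_right; lia.
case: c Nc cN e_def => [|c] Nc cN e_def; first by exfalso; lia.
(* This excludes the leftmost column of the row, where the translated edge would fall outside the
   grid. *)
have par : odd (r + c.+1) != odd N.
  by apply/eqP => od; move: ef; rewrite e_def; apply/negP/no_top; lia.
apply/imsetP; exists (vedge N r c); last by rewrite e_def shift_vedge //; lia.
rewrite inE gyrate_vedge; try lia.
by rewrite -e_def ef vedge_disjoint_right; lia.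
Qed.
End Stability.

(** * The canonical orientation *)

Section Adjacency.
Variables (N : nat) (hN : 0 < N).
Implicit Types (f g : config N) (p q : point N).

Definition odd_point p := odd (p.1 + p.2) == odd N.

Lemma adj_sym g : symmetric (adj g).
Proof. by move=> p q; rewrite /adj setUC. Qed.

Lemma grid_adj p q : [set p; q] \in grid N ->
  p \in vertices N /\ grid_step p q \/ q \in vertices N /\ grid_step q p.
Proof.
case/(gridP hN)=> [] [r [c [rN Nc cN /set2_eq[] [-> ->]]]];
  [left|right|left|right]; by rewrite mem_vertices ?grid_step_pt; lia.
Qed.

Lemma grid_step_irrefl p : grid_step p p = false.
Proof. by rewrite /grid_step; case: p => [[a ?] [b ?]] /=; lia. Qed.

Lemma grid_step_odd p q : grid_step p q -> odd_point q = ~~ odd_point p.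
Proof.
rewrite /grid_step /odd_point; case: p q => [[a ?] [b ?]] [[c ?] [d ?]] /=; lia.
Qed.

Variable f : config N.
Hypothesis fG : f \subset grid N.

Lemma adj_irrefl : irreflexive (adj f).
Proof.
by move=> p; apply/negP => /(subsetP fG)/grid_adj[] [_]; rewrite grid_step_irrefl.
Qed.

Lemma adj_odd p q : adj f p q -> odd_point q = ~~ odd_point p.
Proof.
case/(subsetP fG)/grid_adj=> [] [_ /grid_step_odd]; first by [].
by move=> ->; rewrite negbK.
Qed.

Lemma deg_adj p : deg f p = #|[set q | adj f p q]|.
Proof.
rewrite /deg -(card_in_imset (f := fun q => [set p; q]) (D := [set q | adj f p q])).
  apply: eq_card => e; rewrite inE; apply/andP/imsetP => [[ef pe]|[q]].
    have [r [c e_def]] : exists x y, e = [set x; y].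
      by case/(gridP hN): (subsetP fG _ ef) => [] [r [c [_ _ _ ->]]]; do 2!eexists.
    move: pe; rewrite e_def !inE => /orP[] /eqP p_def; subst p.
      by exists c; rewrite ?inE /adj -?e_def.
    by exists r; rewrite ?inE /adj 1?setUC -?e_def // setUC.
  by rewrite inE => pq ->; rewrite set21.
move=> q s; rewrite !inE => pq ps /set2_eq[] [] //.
by move=> p_def; move: ps; rewrite -p_def adj_irrefl.
Qed.

Lemma adj_low p q : N <= p.1 -> adj f p q ->
  q = pt N N.-1 p.2.
Proof.
move=> Np /(subsetP fG)/grid_adj h.
suff [e1 e2] : q.1 = N.-1 :> nat /\ q.2 = p.2 :> nat by rewrite -(pt_coord q) e1 e2.
move: h Np; rewrite !inE /grid_step.
by case: p => [[a ha] [b hb]]; case: q => [[c hc] [d hd]] /=; lia.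
Qed.

Lemma vertex_or_low p q : adj f p q -> p \in vertices N \/ N <= p.1.
Proof.
case/(subsetP fG)/(gridP hN)=> [] [r [c [rN Nc cN /set2_eq[] [-> _]]]].
- by left; rewrite mem_vertices; lia.
- by left; rewrite mem_vertices; lia.
- by left; rewrite mem_vertices; lia.
have [r1|r1] := ltnP r.+1 N; last by right; rewrite (pt_row c rN).
by left; rewrite mem_vertices; lia.
Qed.

Lemma endpoint_of_deg p : deg f p <= 1 -> endpoint (adj f) p.
Proof.
rewrite deg_adj => /card_le1_eqP d q s pq ps; apply: d; by rewrite inE.
Qed.

Lemma endpoint_low p : N <= p.1 -> endpoint (adj f) p.
Proof. by move=> Np q s /(adj_low Np)-> /(adj_low Np)->. Qed.

Lemma adj_deg2 p q s t : (forall p, p \in vertices N -> deg f p <= 2) ->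
  adj f p q -> adj f p s -> adj f p t -> [|| q == s, q == t | s == t].
Proof.
move=> d2 pq ps p_t; have [pv|Np] := vertex_or_low pq; last first.
  by rewrite (endpoint_low Np pq ps) eqxx.
apply/contraT; rewrite !negb_or => /and3P[qs qt st].
have := d2 p pv; rewrite deg_adj leqNgt => /negP[]; apply/card_gt2P.
by exists q, s, t; rewrite !inE; split; split=> //; rewrite eq_sym.
Qed.
End Adjacency.

(** * The matching formed by the blue edges *)

Section Blue.
Variables (N : nat) (hN : 0 < N) (f : config N) (hf : TFPL f).
Implicit Types (p q : point N) (i j : 'I_N).

Let fG : f \subset grid N. Proof. by case: hf. Qed.

(** This is the bit w of the boundary; it marks the external edges at which an oriented path
    ends. *)
Definition right_end i := [exists j : 'I_N, joined f (ext_end i) (leftv j)]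
  || [exists j : 'I_N, (j < i) && joined f (ext_end i) (ext_end j)].

Lemma ext_end_inj : injective (@ext_end N).
Proof.
move=> [i hi] [j hj] /eqP; rewrite /ext_end pt_eq /=; try lia.
by move=> h; apply/val_inj => /=; lia.
Qed.

Lemma leftv_rightv i j : leftv i <> rightv j.
Proof. by case: i j => [i hi] [j hj] /eqP; rewrite pt_eq /=; lia. Qed.

Lemma ext_leftv i j : ext_end i <> leftv j.
Proof. by case: i j => [i hi] [j hj] /eqP; rewrite pt_eq /=; lia. Qed.

Lemma ext_rightv i j : ext_end i <> rightv j.
Proof. by case: i j => [i hi] [j hj] /eqP; rewrite pt_eq /=; lia. Qed.

Lemma deg_le2 p : p \in vertices N -> deg f p <= 2.
Proof.
move=> pv; case: hf => _ _ d1 d2 _.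
case pe: (p \in leftvs N :|: rightvs N); first exact: leq_trans (d1 p pe) _.
by rewrite d2 // inE pe.
Qed.

Lemma leftv_endpoint i : endpoint (adj f) (leftv i).
Proof.
apply: endpoint_of_deg => //; case: hf => _ _ d1 _ _; apply: d1.
by rewrite inE imset_f.
Qed.

Lemma rightv_endpoint i : endpoint (adj f) (rightv i).
Proof.
apply: endpoint_of_deg => //; case: hf => _ _ d1 _ _; apply: d1.
by rewrite inE orbC imset_f.
Qed.

Lemma ext_endpoint i : endpoint (adj f) (ext_end i).
Proof. by apply: endpoint_low => //; rewrite pt_row. Qed.

Lemma joined_sym p q : joined f p q = joined f q p.
Proof. exact/sym_connect_sym/adj_sym. Qed.

Let uniq_end := @joined_endpoints_uniq _ _ (@adj_sym N f)
  (fun p q s t => @adj_deg2 N hN f fG p q s t deg_le2).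

(** Each alternative of [right_end] would join the external endpoint to a second endpoint other than
    the right vertex, against [joined_endpoints_uniq]. *)
Lemma joined_right_end i j : joined f (ext_end i) (rightv j) -> right_end i = false.
Proof.
move=> ij; apply/negP => /orP[/existsP[k ik]|/existsP[k /andP[ki ik]]].
  apply: (@leftv_rightv k j); apply: uniq_end ik ij;
  by [apply: ext_endpoint|apply: leftv_endpoint|apply: rightv_endpoint
     |apply/eqP/ext_leftv|apply/eqP/ext_rightv].
apply: (@ext_rightv k j); apply: uniq_end ik ij;
  try by [apply: ext_endpoint|apply: rightv_endpoint|apply/eqP/ext_rightv].
by apply/eqP => /ext_end_inj e; rewrite e ltnn in ki.
Qed.

Lemma joined_ext_ends i j : i < j -> joined f (ext_end i) (ext_end j) ->
  right_end i = false /\ right_end j = true.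
Proof.
move=> ij jij; split; last first.
  by apply/orP; right; apply/existsP; exists i; rewrite ij joined_sym.
apply/negP => /orP[/existsP[k ik]|/existsP[k /andP[ki ik]]].
  apply: (@ext_leftv j k); apply: uniq_end jij ik;
  try by [apply: ext_endpoint|apply: leftv_endpoint|apply/eqP/ext_leftv].
  by apply/eqP => /ext_end_inj e; rewrite e ltnn in ij.
suff e : j = k by rewrite -e ltnNge ltnW in ki.
apply: ext_end_inj; apply: uniq_end jij ik;
  try by [apply: ext_endpoint].
  by apply/eqP => /ext_end_inj e; rewrite e ltnn in ij.
by apply/eqP => /ext_end_inj e; rewrite e ltnn in ki.
Qed.

(** These are the boundary points at which the canonical orientation starts, used as positive signs
    in [orientation_with_signs]. *)
Definition out_point p :=
  (p \in leftvs N) || [exists i : 'I_N, (p == ext_end i) && ~~ right_end i].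

Lemma out_leftv i : out_point (leftv i).
Proof. by rewrite /out_point imset_f. Qed.

Lemma out_rightv i : out_point (rightv i) = false.
Proof.
apply/negP => /orP[/imsetP[j _ /esym/leftv_rightv]//|/existsP[j /andP[/eqP e _]]].
by case: (@ext_rightv j i).
Qed.

Lemma out_ext i : out_point (ext_end i) = ~~ right_end i.
Proof.
apply/orP/idP => [[/imsetP[j _ /ext_leftv]//|/existsP[j /andP[/eqP/ext_end_inj-> //]]]|h].
by right; apply/existsP; exists i; rewrite eqxx.
Qed.

(** Two left or two right vertices are never joined in a TFPL; every pair involving an external edge
    is settled by the value of [right_end]. *)
Lemma out_point_alternates p q :
  p \in leftvs N :|: rightvs N :|: [set ext_end i | i : 'I_N] ->
  q \in leftvs N :|: rightvs N :|: [set ext_end i | i : 'I_N] ->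
  p != q -> joined f p q -> out_point p != out_point q.
Proof.
have [_ _ _ _ LR] := hf.
rewrite !inE -!orbA => /or3P[] /imsetP[i _ ->] /or3P[] /imsetP[j _ ->] pq jpq;
rewrite ?out_leftv ?out_rightv ?out_ext //.
- have ij : i != j by apply: contraNneq pq => ->.
  by case: (LR i j ij) => /negP[].
- rewrite joined_sym in jpq; suff -> : right_end j by [].
  by apply/orP; left; apply/existsP; exists i.
- have ij : i != j by apply: contraNneq pq => ->.
  by case: (LR i j ij) => _ /negP[].
- by rewrite joined_sym in jpq; rewrite (joined_right_end jpq).
- suff -> : right_end i by [].
  by apply/orP; left; apply/existsP; exists j.
- by rewrite (joined_right_end jpq).
- have [ij|ji|e] := ltngtP i j.
  + by have [-> ->] := joined_ext_ends ij jpq.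
  + by rewrite joined_sym in jpq; have [-> ->] := joined_ext_ends ji jpq.
  + by rewrite (val_inj e) eqxx in pq.
Qed.

(** An interior vertex has one incoming and one outgoing edge; the blue one is the outgoing edge at
    an odd vertex and the incoming edge at an even one. Left vertices, right vertices and the lower
    ends of the external edges of [f] are odd, so there an edge is blue iff it points away from
    them. *)
Theorem blue_edges_exist : exists B : config N,
  [/\ B \subset f,
      forall p, p \in vertices N :\: (leftvs N :|: rightvs N) -> deg B p = 1,
      forall i, deg B (leftv i) = deg f (leftv i),
      forall i, deg B (rightv i) = 0
    & forall i, (vedge N N.-1 i.*2.+2 \in B) = ~~ right_end i].
Proof.
have [_ ext d1 d2 _] := hf.
have [p|O [O1 O2 O3]] := @orientation_with_signs _ _ (@adj_sym N f)
  (adj_irrefl hN fG) (fun p q s t => @adj_deg2 N hN f fG p q s t deg_le2)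
  (leftvs N :|: rightvs N :|: [set ext_end i | i : 'I_N]) out_point _ out_point_alternates.
  rewrite !inE -orbA => /or3P[] /imsetP[i _ ->];
  by [apply: leftv_endpoint|apply: rightv_endpoint|apply: ext_endpoint].
pose B := [set e in f | [exists p, [exists q, [&& e == [set p; q], odd_point p & O p q]]]].
have Bf : B \subset f by apply/subsetP => e; rewrite inE => /andP[].
have adjB p q : adj B p q = adj f p q && (if odd_point p then O p q else O q p).
  rewrite /adj inE; case pq: (_ \in f) => //=; have par := adj_odd hN fG pq.
  apply/existsP/idP => [[p' /existsP[q' /and3P[/eqP e od Opq]]]|].
    case: (set2_eq e) => [] [? ?]; subst p' q'; first by rewrite od.
    by move: par; rewrite od; case: ifP.
  case: ifP => od Opq; last first.
    by exists q; apply/existsP; exists p; rewrite setUC eqxx par od.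
  by exists p; apply/existsP; exists q; rewrite eqxx od.
have BG : B \subset grid N := subset_trans Bf fG.
exists B; split=> //.
- move=> p pi; have := d2 p pi; rewrite !deg_adj //.
  case/eqP/cards2P=> q [s [qs Ns]].
  have fN x : adj f p x = (x == q) || (x == s).
    by have := congr1 (fun A : {set point N} => x \in A) Ns; rewrite !inE.
  have pq : adj f p q by rewrite fN eqxx.
  have ps : adj f p s by rewrite fN eqxx orbT.
  have qp : adj f q p by rewrite adj_sym.
  have := O2 _ _ _ qp ps qs; have := O1 _ _ pq; have := O1 _ _ ps.
  move=> Osp Oqp Oqps.
  (* The orientation passes through [p], so exactly one of its two edges leaves [p]. *)
  have [t Bt] : exists t, [set x | adj B p x] = [set t].
    case Opq: (if odd_point p then O p q else O q p); [exists q|exists s];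
    apply/setP => x; rewrite !inE adjB fN.
      case: eqP => [->|_] //=; case: eqP => [->|_] //=.
      by move: Opq; case: ifP => _; rewrite ?Osp -Oqps Oqp => ->.
    case: eqP => [->|_] //=; first by rewrite Opq (negPf qs).
    case: eqP => [->|_] //=.
    by move: Opq; case: ifP => _; rewrite ?Osp -Oqps Oqp => ->.
  by rewrite Bt cards1.
- move=> i; rewrite !deg_adj //; apply: eq_card => q; rewrite !inE adjB.
  apply/andb_idr => pq.
  have -> : odd_point (leftv i)
    by case: (i) => j hj; rewrite /odd_point pt_row ?pt_col /=; lia.
  by rewrite (O3 _ _ _ pq) ?out_leftv // !inE imset_f.
- move=> i; rewrite deg_adj //; apply/eqP; rewrite cards_eq0; apply/eqP/setP => q.
  rewrite !inE adjB; apply/negP => /andP[pq].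
  have -> : odd_point (rightv i)
    by case: (i) => j hj; rewrite /odd_point pt_row ?pt_col /=; lia.
  by rewrite (O3 _ _ _ pq) ?out_rightv // !inE imset_f // orbT.
- move=> i.
  have eE : vedge N N.-1 i.*2.+2 = [set ext_end i; pt N N.-1 i.*2.+2].
    by rewrite /vedge prednK // setUC.
  have ef : adj f (ext_end i) (pt N N.-1 i.*2.+2).
    case: i eE => i iN /= eE; have jb : i.*2.+1 < N.*2.+1 by lia.
    have := ext (Ordinal jb); rewrite /ext_edge /adj eE /= => ->; lia.
  have := adjB (ext_end i) (pt N N.-1 i.*2.+2); rewrite ef /adj -eE => ->.
  have -> : odd_point (ext_end i)
    by case: (i) => j hj; rewrite /odd_point pt_row ?pt_col /=; lia.
  by rewrite (O3 _ _ _ ef) ?out_ext // !inE imset_f // !orbT.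
Qed.
End Blue.

(** * Counting edges of a pair of matchings *)

Local Open Scope ring_scope.

(* The odd vertices of row r are o_0, ..., o_(r+1) and the even ones e_0, ..., e_r,
   in the order o_0, e_0, o_1, ..., e_r, o_(r+1).  The edge o_m e_m of row r is in
   the matching iff P r m, and e_m o_(m+1) iff Q r m; the vertical edges below e_m
   and o_m are in it iff D r.+1 m and E r.+1 m.  The bits dl r and dr r are the
   degrees of the leftmost and rightmost vertex of row r, and b m is the bit of
   the m-th external edge. *)
Record matching (N : nat) (P Q D E : nat -> nat -> bool) (dl dr b : nat -> bool)
    : Prop := Matching {
  matching_top : forall m, D 0%N m = false /\ E 0%N m = false;
  matching_bot : forall m, (m < N)%N -> D N m = b m;
  matching_bot_odd : forall m, (m <= N)%N -> E N m = false;
  matching_even : forall r m, (m <= r < N)%N ->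
    (P r m + Q r m + D r.+1 m + E r m = 1)%N;
  matching_odd : forall r m, (m < r < N)%N ->
    (P r m.+1 + Q r m + D r m + E r.+1 m.+1 = 1)%N;
  matching_left : forall r, (r < N)%N -> (P r 0 + E r.+1 0 = dl r)%N;
  matching_right : forall r, (r < N)%N -> (Q r r + E r.+1 r.+1 = dr r)%N }.

(** The reflection sends o_m to o_(r+1-m) and e_m to e_(r-m) in row r. The vertical edges on line r
    hang from row r - 1, hence the indices [r.-1 - m] and [r - m]. *)
Lemma matching_mirror N P Q D E dl dr b : matching N P Q D E dl dr b ->
  matching N (fun r m => Q r (r - m)%N) (fun r m => P r (r - m)%N)
    (fun r m => D r (r.-1 - m)%N) (fun r m => E r (r - m)%N)
    dr dl (fun m => b (N.-1 - m)%N).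
Proof.
case=> top bot boto ev od le ri; split.
- by move=> m; split; [case: (top (0.-1 - m)%N)|case: (top (0 - m)%N)].
- by move=> m mN; apply: bot; lia.
- by move=> m mN; apply: boto; lia.
- move=> r m /andP[mr rN]; have := ev r (r - m)%N; rewrite /=; lia.
- move=> r m /andP[mr rN]; have := od r (r.-1 - m)%N.
  have -> : (r - m = (r.-1 - m).+1)%N by lia.
  have -> : (r - m.+1 = r.-1 - m)%N by lia.
  have -> : (r.+1 - m.+1 = (r.-1 - m).+1)%N by lia.
  lia.
- by move=> r rN; rewrite !subn0 ri.
- by move=> r rN; rewrite !subnn le.
Qed.

(** Solving a degree condition for one edge turns the row identities below into polynomial
    identities. *)
Lemma third_of_four (a b c d : bool) : (a + b + c + d = 1)%N ->
  c%:Z = 1 - a%:Z - b%:Z - d%:Z.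
Proof. by case: a; case: b; case: c; case: d. Qed.

Lemma fourth_of_four (a b c d : bool) : (a + b + c + d = 1)%N ->
  d%:Z = 1 - a%:Z - b%:Z - c%:Z.
Proof. by case: a; case: b; case: c; case: d. Qed.

Lemma ge0_eq_add (x y z : int) : 0 <= x -> 0 <= y -> z = x + y -> 0 <= z.
Proof. by move=> x0 y0 ->; apply: addr_ge0. Qed.

Definition flux (D E : nat -> bool) (j : nat) : int :=
  \sum_(m < j) ((D m)%:Z - (E m)%:Z).

(* The signed number of pairs of vertical edges on one horizontal line, the first
   in (D', E'), the second in (D, E) and to the right of the first; edges in E or
   E' count negatively. *)
Definition crossings (D' E' D E : nat -> bool) (j : nat) : int :=
  \sum_(m < j) ((flux D' E' m - (E' m)%:Z) * (D m)%:Z - flux D' E' m * (E m)%:Z).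

(* The weight m - l + 1 is k - r if o_k of row r is the odd endpoint of the edge. *)
Definition moment (D E : nat -> bool) (l j : nat) : int :=
  \sum_(m < j) ((D m)%:Z - (E m)%:Z) * (m%:Z - l%:Z + 1).

Lemma fluxS D E j : flux D E j.+1 = flux D E j + ((D j)%:Z - (E j)%:Z).
Proof. by rewrite /flux big_ord_recr. Qed.
Lemma momentS D E l j : moment D E l j.+1 =
  moment D E l j + ((D j)%:Z - (E j)%:Z) * (j%:Z - l%:Z + 1).
Proof. by rewrite /moment big_ord_recr. Qed.
Lemma crossingsS D' E' D E j : crossings D' E' D E j.+1 =
  crossings D' E' D E j +
  ((flux D' E' j - (E' j)%:Z) * (D j)%:Z - flux D' E' j * (E j)%:Z).
Proof. by rewrite /crossings big_ord_recr. Qed.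

(** * Flux and moment across a row *)

Section Rows.
Variables (N : nat) (P Q D E : nat -> nat -> bool) (dl dr b : nat -> bool).
Hypothesis M : matching N P Q D E dl dr b.

(** Subtract the degree conditions at o_0, ..., o_j from those at e_0, ..., e_(j-1): the horizontal
    edges cancel, except the edge o_j e_j at the cut. *)
Lemma flux_row r j : (j <= r < N)%N ->
  flux (D r.+1) (E r.+1) j - (E r.+1 j)%:Z =
  flux (D r) (E r) j + (P r j)%:Z - (dl r)%:Z.
Proof.
elim: j => [|j IH] /andP[jr rN].
  rewrite /flux !big_ord0 -(matching_left M rN) PoszD; ring.
have jrN : (j <= r < N)%N by rewrite (ltnW jr).
have jrN' : (j < r < N)%N by rewrite jr.
have := IH jrN; rewrite !fluxS.
rewrite (third_of_four (matching_even M jrN)) (fourth_of_four (matching_odd M jrN')).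
move/(canRL (subrK _)) => ->; ring.
Qed.

Hypothesis dr0 : forall r, dr r = false.

Lemma matching_right0 r : (r < N)%N -> Q r r = false /\ E r.+1 r.+1 = false.
Proof. by move=> /(matching_right M); rewrite dr0; case: (Q r r); case: (E _ _). Qed.

Lemma matching_right_above r : (r < N)%N -> E r r = false.
Proof.
case: r => [|r] rN; first by case: (matching_top M 0).
by case: (@matching_right0 r); first exact: ltnW.
Qed.

(** On the bottom line this equates the number of external edges of the matching with the number of
    uncovered left vertices. *)
Lemma flux_total r : (r <= N)%N ->
  flux (D r) (E r) r = \sum_(i < r) (1 - (dl i)%:Z).
Proof.
elim: r => [|r IH] rN; first by rewrite /flux !big_ord0.
rewrite big_ord_recr /= -IH; last exact: ltnW.
have rrN : (r <= r < N)%N by rewrite leqnn.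
have := flux_row rrN; rewrite fluxS (third_of_four (matching_even M rrN)).
have [-> _] := matching_right0 rN; rewrite (matching_right_above rN).
move/(canRL (subrK _)) => -> /=; ring.
Qed.

(** As in [flux_row], with the conditions at o_m and e_m weighted by m - r: edges of [P] cancel,
    while each edge of [Q r] and [E r] leaves one unit. *)
Lemma moment_row r j : (j <= r < N)%N ->
  moment (D r.+1) (E r.+1) r.+1 j - (E r.+1 j)%:Z * (j%:Z - r%:Z) =
  moment (D r) (E r) r j + (j%:Z - r%:Z) * (P r j)%:Z
  + \sum_(m < j) ((Q r m)%:Z + (E r m)%:Z) + r%:Z * (dl r)%:Z - j%:Z.
Proof.
elim: j => [|j IH] /andP[jr rN].
  rewrite /moment !big_ord0; have := matching_left M rN.
  by case: (P r 0); case: (E r.+1 0); case: (dl r) => //=; lia.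
have jrN : (j <= r < N)%N by rewrite (ltnW jr).
have jrN' : (j < r < N)%N by rewrite jr.
have := IH jrN; rewrite !momentS big_ord_recr /=.
rewrite (third_of_four (matching_even M jrN)) (fourth_of_four (matching_odd M jrN')).
move/(canRL (subrK _)) => ->; rewrite !intS; ring.
Qed.

Lemma moment_total r : (r <= N)%N ->
  moment (D r) (E r) r r =
  \sum_(i < r) (\sum_(m < i.+1) ((Q i m)%:Z + (E i m)%:Z) - i%:Z * (1 - (dl i)%:Z)).
Proof.
elim: r => [|r IH] rN; first by rewrite /moment !big_ord0.
rewrite big_ord_recr /= -IH; last exact: ltnW.
have := @moment_row r r; rewrite leqnn rN => /(_ isT).
rewrite momentS big_ord_recr /=.
have [-> _] := matching_right0 rN; rewrite (matching_right_above rN).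
move/(canRL (subrK _)) => ->; rewrite !intS /=; ring.
Qed.

End Rows.

(* The change of crossings_row from j to j + 1; the terms containing the flux cancel. *)
Lemma crossing_step (p q d e p1 a e1 p' q' d' e' p1' a' e1' : bool) :
  (p + q + d + e = 1)%N -> (p1 + q + a + e1 = 1)%N ->
  (p' + q' + d' + e' = 1)%N -> (p1' + q' + a' + e1' = 1)%N ->
  ~~ (p && p') -> ~~ (q && q') -> ~~ (d && d') -> ~~ (e1 && e1') ->
  ~~ (a && a') -> ~~ (e && e') ->
  p'%:Z * d%:Z + e'%:Z * a%:Z + (a'%:Z - e'%:Z) * (1 - p1%:Z)
  <= (p'%:Z + d'%:Z) * e1%:Z + q%:Z + p'%:Z.
Proof.
case: p; case: q; case: d; case: e => // _; case: p1; case: a; case: e1 => // _;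
by case: p'; case: q'; case: d'; case: e' => // _; case: p1'; case: a'; case: e1'.
Qed.

(** * Crossings of red and blue edges *)

Section Crossings.
Variables (N : nat) (P Q D E : nat -> nat -> bool) (dl dr b : nat -> bool).
Hypothesis M : matching N P Q D E dl dr b.
Hypothesis dr0 : forall r, dr r = false.
Variables (P' Q' D' E' : nat -> nat -> bool) (dl' dr' b' : nat -> bool).
Hypothesis M' : matching N P' Q' D' E' dl' dr' b'.
Hypothesis dl0 : forall r, dl' r = false.
Hypothesis disj : forall r m,
  ~~ (P r m && P' r m) /\ ~~ (Q r m && Q' r m) /\
  ~~ (D r m && D' r m) /\ ~~ (E r m && E' r m).

(** Induction from left to right along the row. The two flux terms account for the edges at the cut
    through o_j and make each step local, so that [crossing_step] decides it. *)
Lemma crossings_row r j : (j <= r < N)%N ->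
  crossings (D' r.+1) (E' r.+1) (D r.+1) (E r.+1) j
    - flux (D' r.+1) (E' r.+1) j * (E r.+1 j)%:Z
    - crossings (D' r) (E' r) (D r) (E r) j
    + flux (D' r) (E' r) j * (1 - (P r j)%:Z)
  <= \sum_(m < j) ((Q r m)%:Z + (P' r m)%:Z).
Proof.
elim: j => [|j IH] /andP[jr rN].
  by rewrite /crossings /flux !big_ord0 !mul0r !subr0 /=.
have jrN : (j <= r < N)%N by rewrite (ltnW jr).
have jrN' : (j < r < N)%N by rewrite jr.
have ev := matching_even M jrN; have od := matching_odd M jrN'.
have ev' := matching_even M' jrN; have od' := matching_odd M' jrN'.
have := crossing_step ev od ev' od' (disj r j).1 (disj r j).2.1
  (disj r.+1 j).2.2.1 (disj r.+1 j.+1).2.2.2 (disj r j).2.2.1 (disj r j).2.2.2.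
have := flux_row M' jrN; rewrite dl0 => /(canRL (subrK _)) K1.
move: (IH jrN); rewrite !crossingsS !fluxS K1 big_ord_recr /=.
rewrite (third_of_four ev) (fourth_of_four od).
move=> h1 h2; rewrite -subr_ge0 in h1; rewrite -subr_ge0 in h2; rewrite -subr_ge0.
apply: (ge0_eq_add h1 h2); ring.
Qed.

Lemma crossings_total r : (r <= N)%N ->
  crossings (D' r) (E' r) (D r) (E r) r <=
  \sum_(i < r) \sum_(m < i.+1) ((Q i m)%:Z + (P' i m)%:Z).
Proof.
elim: r => [|r IH] rN; first by rewrite /crossings !big_ord0.
rewrite big_ord_recr /=; have := IH (ltnW rN).
have rrN : (r <= r < N)%N by rewrite leqnn.
have := crossings_row rrN.
have := flux_row M' rrN; rewrite dl0 => /(canRL (subrK _)) K1.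
rewrite crossingsS K1 [\sum_(m < r.+1) _]big_ord_recr /=.
rewrite (third_of_four (matching_even M rrN)).
have [-> _] := matching_right0 M dr0 rN; rewrite (matching_right_above M dr0 rN) /=.
(* This product is the slack contributed by the last even vertex of the row. *)
have : 0 <= (P' r r)%:Z * (P r r)%:Z :> int by [].
move=> h0 h1 h2; rewrite -subr_ge0 in h1; rewrite -subr_ge0 in h2; rewrite -subr_ge0.
apply: (ge0_eq_add h0 (addr_ge0 h1 h2)); ring.
Qed.
End Crossings.

(** * Inversions of words and the resulting bound *)

Definition inversions (s : nat -> bool) (n : nat) : int :=
  \sum_(j < n) (~~ s j)%:Z * \sum_(i < j) (s i)%:Z.

Lemma negbZ (b : bool) : (~~ b)%:Z = 1 - b%:Z.
Proof. by case: b. Qed.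

Lemma eq_inversions s t n : (forall i, (i < n)%N -> s i = t i) ->
  inversions s n = inversions t n.
Proof.
move=> st; apply: eq_bigr => j _; rewrite st //; congr (_ * _).
by apply: eq_bigr => i _; rewrite st // (ltn_trans (ltn_ord i)).
Qed.

(** A zero at position j is preceded by j ones less the earlier zeros, so with z zeros the
    inversions are the sum of their positions minus z(z-1)/2; doubling avoids the division. *)
Lemma inversions_moment s n :
  2 * inversions s n = 2 * (\sum_(j < n) (~~ s j)%:Z * j%:Z)
    - (\sum_(j < n) (~~ s j)%:Z) * (\sum_(j < n) (~~ s j)%:Z - 1).
Proof.
rewrite /inversions; elim: n => [|n IH]; first by rewrite !big_ord0.
rewrite !big_ord_recr /= mulrDr IH.
have -> : \sum_(i < n) (s i)%:Z = n%:Z - \sum_(j < n) (~~ s j)%:Z.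
  rewrite (eq_bigr (fun j : 'I_n => 1 - (~~ s j)%:Z)) => [|i _]; last by case: (s i).
  by rewrite sumrB sumr_const card_ord -natz; ring.
by case: (s n); rewrite /=; ring.
Qed.

Lemma inversions_pairs s n : inversions s n =
  \sum_(j < n) \sum_(i < n) (i < j)%N%:Z * ((~~ s j)%:Z * (s i)%:Z).
Proof.
apply: eq_bigr => j _.
rewrite (big_ord_widen n (fun i => (s i)%:Z)) 1?ltnW // mulr_sumr [LHS]big_mkcond.
by apply: eq_bigr => i _; case: (i < j)%N; rewrite ?mul1r ?mul0r.
Qed.

Lemma inversions_rev s n :
  inversions (fun j => ~~ s (n.-1 - j)%N) n = inversions s n.
Proof.
rewrite !inversions_pairs exchange_big (reindex_inj rev_ord_inj) /=.
apply: eq_bigr => j _; rewrite (reindex_inj rev_ord_inj) /=.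
apply: eq_bigr => i _.
have jn := ltn_ord j; have iN := ltn_ord i.
have -> : (n.-1 - (n - i.+1) = i)%N by lia.
have -> : (n.-1 - (n - j.+1) = j)%N by lia.
have -> : (n - j.+1 < n - i.+1)%N = (i < j)%N by lia.
by rewrite negbK [_%:Z * (s i)%:Z]mulrC.
Qed.

Lemma flux_even D E n : (forall m, (m < n)%N -> E m = false) ->
  flux D E n = \sum_(m < n) (D m)%:Z.
Proof. by move=> E0; apply: eq_bigr => m _; rewrite E0 // subr0. Qed.

(** Evaluate [moment_total] on the bottom line. [inversions_moment] turns both position sums into
    inversions, and the quadratic terms agree because by [flux_total] the two words have equally
    many zeros. *)
Lemma left_moves N P Q D E dl dr b : matching N P Q D E dl dr b ->
  (forall r, dr r = false) ->
  \sum_(i < N) \sum_(m < i.+1) ((Q i m)%:Z + (E i m)%:Z) =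
  inversions (fun j => ~~ b j) N - inversions (fun j => dl (N.-1 - j)%N) N.
Proof.
move=> M dr0; have EN m : (m < N)%N -> E N m = false.
  by move=> mN; apply: (matching_bot_odd M); apply: ltnW.
have := moment_total M dr0 (leqnn N); have := flux_total M dr0 (leqnn N).
rewrite flux_even // => F.
have -> : moment (D N) (E N) N N = \sum_(m < N) (b m)%:Z * m%:Z
    - (N%:Z - 1) * \sum_(m < N) (b m)%:Z.
  rewrite mulr_sumr -sumrB; apply: eq_bigr => m _.
  by rewrite EN // (matching_bot M) //=; ring.
have Fb : \sum_(m < N) (b m)%:Z = \sum_(i < N) (1 - (dl i)%:Z).
  by rewrite -F; apply: eq_bigr => m _; rewrite (matching_bot M).
have I1 := inversions_moment (fun j => ~~ b j) N.
have I2 := inversions_moment (fun j => dl (N.-1 - j)%N) N.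
have B1 : \sum_(j < N) (~~ ~~ b j)%:Z = \sum_(m < N) (b m)%:Z.
  by apply: eq_bigr => m _; rewrite negbK.
have B2 : \sum_(j < N) (~~ ~~ b j)%:Z * j%:Z = \sum_(m < N) (b m)%:Z * m%:Z.
  by apply: eq_bigr => m _; rewrite negbK.
have B3 : \sum_(j < N) (~~ dl (N.-1 - j)%N)%:Z = \sum_(m < N) (b m)%:Z.
  rewrite Fb (reindex_inj rev_ord_inj) /=; apply: eq_bigr => j _.
  rewrite negbZ; congr (1 - (dl _)%:Z); have := ltn_ord j; lia.
have B4 : \sum_(j < N) (~~ dl (N.-1 - j)%N)%:Z * j%:Z =
    (N%:Z - 1) * (\sum_(m < N) (b m)%:Z) - \sum_(i < N) i%:Z * (1 - (dl i)%:Z).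
  rewrite Fb (reindex_inj rev_ord_inj) mulr_sumr -sumrB /=; apply: eq_bigr => j _.
  have jN := ltn_ord j; have -> : (N.-1 - (N - j.+1) = j)%N by lia.
  have -> : (N - j.+1)%N%:Z = N%:Z - 1 - j%:Z by lia.
  by rewrite negbZ; ring.
rewrite B1 B2 in I1; rewrite B3 B4 in I2.
rewrite sumrB => /esym/(canRL (subrK _)) ->.
apply: (@mulfI _ 2) => //; rewrite mulrBr I1 I2; ring.
Qed.

(** [L] counts [Q] with [E], and the mirrored [L'] counts [P'] with [E']. Subtracting from their sum
    the lower bound [C] on [Q] with [P'] leaves the edges in [E] and [E']. *)
Theorem odd_top_edges_bound N P Q D E P' Q' D' E' dl dr w :
  matching N P Q D E dl (fun=> false) (fun i => ~~ w i) ->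
  matching N P' Q' D' E' (fun=> false) dr w ->
  (forall r m, ~~ (P r m && P' r m) /\ ~~ (Q r m && Q' r m) /\
     ~~ (D r m && D' r m) /\ ~~ (E r m && E' r m)) ->
  \sum_(i < N) \sum_(m < i.+1) ((E i m)%:Z + (E' i m)%:Z) <=
  inversions w N - inversions (fun j => dl (N.-1 - j)%N) N
    - inversions (fun j => ~~ dr j) N.
Proof.
move=> M M' dis.
have C := crossings_total M (fun=> erefl) M' (fun=> erefl) dis (leqnn N).
have L := left_moves M (fun=> erefl).
have L' := left_moves (matching_mirror M') (fun=> erefl).
have EN m : (m < N)%N -> E N m = false.
  by move=> mN; apply: (matching_bot_odd M); apply: ltnW.
have EN' m : (m < N)%N -> E' N m = false.
  by move=> mN; apply: (matching_bot_odd M'); apply: ltnW.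
(* On the bottom line the pairs are a red external edge left of a blue one, that is, a 1 of [w]
   before a 0. *)
have W : crossings (D' N) (E' N) (D N) (E N) N = inversions w N.
  apply: eq_bigr => m _; rewrite EN // EN' // mulr0 !subr0.
  rewrite (matching_bot M) // flux_even => [|i im]; last first.
    by apply: EN'; apply: ltn_trans im _.
  rewrite mulrC; congr (_ * _); apply: eq_bigr => i _.
  by rewrite (matching_bot M') // (ltn_trans (ltn_ord i)).
have R : \sum_(i < N) \sum_(m < i.+1) ((P' i (i - m)%N)%:Z + (E' i (i - m)%N)%:Z)
    = \sum_(i < N) \sum_(m < i.+1) ((P' i m)%:Z + (E' i m)%:Z).
  apply: eq_bigr => i _; rewrite [RHS](reindex_inj rev_ord_inj) /=.
  by apply: eq_bigr => m _; rewrite subSS.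
rewrite R (inversions_rev w) in L'.
have V : inversions (fun j => dr (N.-1 - j)%N) N = inversions (fun j => ~~ dr j) N.
  rewrite -inversions_rev; apply: eq_inversions => i iN; congr (~~ dr _); lia.
rewrite V in L'; rewrite W in C.
have Lx : inversions (fun j => ~~ ~~ w j) N = inversions w N.
  by apply: eq_inversions => i _; rewrite negbK.
rewrite Lx in L; move: C L L'.
have sp (F G : nat -> nat -> bool) :
  \sum_(i < N) \sum_(m < i.+1) ((F i m)%:Z + (G i m)%:Z) =
  \sum_(i < N) \sum_(m < i.+1) (F i m)%:Z + \sum_(i < N) \sum_(m < i.+1) (G i m)%:Z.
  by rewrite -big_split /=; apply: eq_bigr => i _; rewrite big_split.
rewrite !sp => C L L'; lia.
Qed.

Local Close Scope ring_scope.

(** * The bound by the excess *)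

Section ConfigMatching.
Variables (N : nat) (hN : 0 < N).
Implicit Types (g : config N).

Definition right_of_odd g r m := hedge N r (N - r + m.*2) \in g.
Definition left_of_odd g r m := hedge N r (N - r + m.*2).+1 \in g.
Definition below_even g l m :=
  (0 < l) && (vedge N l.-1 (N - l.-1 + m.*2).+1 \in g).
Definition below_odd g l m :=
  (0 < l) && (vedge N l.-1 (N - l.-1 + m.*2) \in g).

Lemma config_matching g (dl dr b : nat -> bool) : g \subset grid N ->
  (forall p, p \in vertices N :\: (leftvs N :|: rightvs N) -> deg g p = 1) ->
  (forall r, r < N -> deg g (pt N r (N - r)) = dl r) ->
  (forall r, r < N -> deg g (pt N r (N + r + 2)) = dr r) ->
  (forall m, m < N -> (vedge N N.-1 m.*2.+2 \in g) = b m) ->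
  (forall m, m <= N -> vedge N N.-1 m.*2.+1 \notin g) ->
  matching N (right_of_odd g) (left_of_odd g) (below_even g) (below_odd g) dl dr b.
Proof.
move=> gG d1 dL dR eb eo.
have offv r c : 0 < r -> r < N -> c <= N.*2.+1 -> (c < N - r.-1) || (N + r.-1 + 2 < c) ->
    (vedge N r.-1 c \in g) = false.
  move=> r0 rN cN oc; apply/negP => /(subsetP gG)/(vedge_in_grid hN)[]; lia.
split.
- by [].
- move=> m mN; rewrite /below_even hN -eb //=; congr (vedge N _ _ \in g); lia.
- move=> m mN; rewrite /below_odd hN /=; apply/negbTE.
  have -> : N - N.-1 + m.*2 = m.*2.+1 by lia.
  exact: eo.
- move=> r m /andP[mr rN].
  have := d1 (pt N r (N - r + m.*2).+1) (mem_interior _ _ _ _).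
  rewrite (deg_pt hN gG) /=; try lia.
  have -> : (N - r + m.*2).+1 <= N + r + 1 by lia.
  rewrite /right_of_odd /left_of_odd /below_even /below_odd /=.
  case: r mr rN => [|r] mr rN /=; first by lia.
  have -> : N - r + m.*2 = (N - r.+1 + m.*2).+1 by lia.
  lia.
- move=> r m /andP[mr rN].
  have := d1 (pt N r (N - r + m.+1.*2)) (mem_interior _ _ _ _).
  rewrite (deg_pt hN gG) /=; try lia.
  have -> : N - r + m.+1.*2 <= N + r + 1 by lia.
  rewrite /right_of_odd /left_of_odd /below_even /below_odd /=.
  case: r mr rN => [|r] mr rN //=.
  have -> : (N - r.+1 + m.+1.*2).-1 = (N - r.+1 + m.*2).+1 by lia.
  have -> : (N - r + m.*2).+1 = N - r.+1 + m.+1.*2 by lia.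
  lia.
- move=> r rN; rewrite -dL // (deg_pt hN gG) /=; try lia.
  have -> : N - r <= N + r + 1 by lia.
  have -> : (hedge N r (N - r).-1 \in g) = false.
    apply/negP => /(subsetP gG)/(hedge_in_grid hN)[]; lia.
  have -> : (0 < r) && (vedge N r.-1 (N - r) \in g) = false.
    by apply/negP => /andP[r0]; rewrite offv //; lia.
  by rewrite /right_of_odd /below_odd /= !addn0.
- move=> r rN; rewrite -dR // (deg_pt hN gG) /=; try lia.
  have -> : (N + r + 2 <= N + r + 1) = false by lia.
  have -> : (0 < r) && (vedge N r.-1 (N + r + 2) \in g) = false.
    by apply/negP => /andP[r0]; rewrite offv //; lia.
  rewrite /left_of_odd /below_odd /=.
  have -> : (N + r + 2).-1 = (N - r + r.*2).+1 by lia.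
  have -> : N + r + 2 = N - r + r.+1.*2 by lia.
  by rewrite !addn0.
Qed.
End ConfigMatching.


Lemma young_size_inversionsE n (s : n.-tuple bool) :
  (young_size s)%:Z%R = inversions (nth false s) n.
Proof.
rewrite young_size_inversions inversions_pairs -sum1dep_card.
rewrite (eq_bigl (fun p : 'I_n * 'I_n =>
  [&& p.1 < p.2, tnth s p.1 & ~~ tnth s p.2])) // big_mkcond /=.
rewrite -(pair_big xpredT xpredT (fun i j : 'I_n =>
  if [&& i < j, tnth s i & ~~ tnth s j] then 1 else 0)) /= exchange_big /=.
rewrite -natz natr_sum; apply: eq_bigr => j _; rewrite natr_sum; apply: eq_bigr => i _.
rewrite !(tnth_nth false).
by case: (i < j); case: (nth _ _ i); case: (nth _ _ j).
Qed.

(** Each such edge, blue or red, contributes a positive term to a sum of nonnegative terms bounded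
    by the excess. *)
Lemma odd_top_edges_absent N (f : config N) u v w : 0 < N -> TFPL f ->
  boundary f = (u, v, w) -> excess u v w = 0%R ->
  forall r c, r < N -> N <= r + c -> c <= N + r + 2 -> odd (r + c) = odd N ->
  vedge N r c \notin f.
Proof.
move=> hN hf [eu ev ew] he.
have [fG ext d1 d2 _] := hf.
have [B [Bf B1 Bl Br Be]] := blue_edges_exist hN hf.
pose R := f :\: B.
have Rf : R \subset f := subsetDl f B.
have degR p : deg R p = deg f p - deg B p.
  rewrite /deg -(cardsID B [set e in f | p \in e]).
  have -> : [set e in f | p \in e] :&: B = [set e in B | p \in e].
    apply/setP => e; rewrite !inE; case eB: (e \in B); rewrite ?andbF //.
    by rewrite (subsetP Bf _ eB) andbT.
  have -> : [set e in f | p \in e] :\: B = [set e in R | p \in e].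
    by apply/setP => e; rewrite !inE andbA.
  by rewrite addKn.
pose wn := nth false w; pose un := nth false u; pose vn := nth false v.
have wE (i : 'I_N) : wn i = right_end f i.
  by rewrite /wn -ew -tnth_nth tnth_mktuple.
have uE (i : 'I_N) : un i = (deg f (leftv i) == 1).
  by rewrite /un -eu -tnth_nth tnth_mktuple.
have vE (i : 'I_N) : vn i = (deg f (rightv i) == 0).
  by rewrite /vn -ev -tnth_nth tnth_mktuple.
have L_le (i : 'I_N) : deg f (leftv i) <= 1 by apply: d1; rewrite inE imset_f.
have R_le (i : 'I_N) : deg f (rightv i) <= 1 by apply: d1; rewrite inE orbC imset_f.
(* Left vertices are numbered from the bottom row upwards, so rows and letters of [u] run in
   opposite directions. *)
have leftE r (rN : r < N) : {i : 'I_N | pt N r (N - r) = leftv i & N.-1 - r = i}.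
  have h : N.-1 - r < N by lia.
  by exists (Ordinal h) => //; rewrite /leftv /=; congr pt; lia.
have rightE r (rN : r < N) : pt N r (N + r + 2) = rightv (Ordinal rN) by [].
have bot_even m : m < N -> vedge N N.-1 m.*2.+2 \in f.
  move=> mN; have h : m.*2.+1 < N.*2.+1 by lia.
  by have := ext (Ordinal h); rewrite /ext_edge /= => ->; lia.
have bot_odd m : m <= N -> vedge N N.-1 m.*2.+1 \notin f.
  move=> mN; have h : m.*2 < N.*2.+1 by lia.
  by have := ext (Ordinal h); rewrite /ext_edge /= => ->; lia.
have MB : matching N (right_of_odd B) (left_of_odd B) (below_even B) (below_odd B)
    (fun r => un (N.-1 - r)) (fun=> false) (fun i => ~~ wn i).
  apply: config_matching => //; first exact: subset_trans Bf fG.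
  - move=> r rN; have [i -> ->] := leftE r rN; rewrite Bl uE.
    by case: (deg f _) (L_le i) => [|[]].
  - by move=> r rN; rewrite rightE Br.
  - by move=> m mN; rewrite (Be (Ordinal mN)) -(wE (Ordinal mN)).
  - by move=> m /bot_odd; apply: contra => /(subsetP Bf).
have MR : matching N (right_of_odd R) (left_of_odd R) (below_even R) (below_odd R)
    (fun=> false) (fun r => ~~ vn r) wn.
  apply: config_matching => //; first exact: subset_trans Rf fG.
  - by move=> p pi; rewrite degR d2 // B1.
  - by move=> r rN; have [i -> _] := leftE r rN; rewrite degR Bl subnn.
  - move=> r rN; rewrite rightE degR Br subn0 (vE (Ordinal rN)).
    by case: (deg f _) (R_le (Ordinal rN)) => [|[]].
  - move=> m mN; rewrite inE bot_even // andbT.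
    by rewrite (Be (Ordinal mN)) -(wE (Ordinal mN)) negbK.
  - by move=> m /bot_odd; apply: contra => /(subsetP Rf).
have dis e : ~~ ((e \in B) && (e \in R)) by rewrite inE; case: (e \in B).
have disv b e : ~~ ((b && (e \in B)) && (b && (e \in R))).
  by case: b; rewrite /= ?dis.
have dis4 r m :
    ~~ (right_of_odd B r m && right_of_odd R r m) /\
    ~~ (left_of_odd B r m && left_of_odd R r m) /\
    ~~ (below_even B r m && below_even R r m) /\
    ~~ (below_odd B r m && below_odd R r m).
  by split; [exact: dis|split; [exact: dis|split; exact: disv]].
have := odd_top_edges_bound MB MR dis4.
have -> : inversions (fun j => un (N.-1 - (N.-1 - j))) N = inversions un N.
  by apply: eq_inversions => i iN; congr un; lia.
have -> : inversions (fun j => ~~ ~~ vn j) N = inversions vn N.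
  by apply: eq_inversions => i iN; rewrite negbK.
rewrite -!young_size_inversionsE -/(excess u v w) he => bound.
move=> r c rN Nc cN od; apply/negP => vf.
(* The odd vertices of row r sit in columns N - r + 2m. *)
pose m := (c - (N - r))./2.
have cE : c = N - r + m.*2 by rewrite /m; lia.
have rN1 : r.+1 < N.
  rewrite ltnNge; apply/negP => Nr; have mN : m <= N by lia.
  move: (bot_odd m mN); have -> : N.-1 = r by lia.
  have -> : m.*2.+1 = c by lia.
  by rewrite vf.
have mr : m < r.+2 by lia.
move: bound; apply/negP; rewrite -ltNge.
(* The edges below row r form line r + 1, which is in the range of the sum because the bottom line
   has no edge below an odd vertex. *)
rewrite (bigD1 (Ordinal rN1)) //= (bigD1 (Ordinal mr)) //=.
apply: ltr_pwDl; last by apply: sumr_ge0 => i _; apply: sumr_ge0 => j _; apply: addr_ge0.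
apply: ltr_pwDl; last by apply: sumr_ge0 => j _; apply: addr_ge0.
rewrite /below_odd /= -cE /R inE vf andbT.
by case: (_ \in B).
Qed.

Theorem proposition4p2 (N : nat) (hN : 0 < N) (f : config N)
    (u v w : N.-tuple bool) (hf : TFPL f) (hb : boundary f = (u, v, w))
    (he : excess u v w = 0%R) :
  WL f = f.
Proof.
exact: (no_odd_top_stable hN hf (odd_top_edges_absent hN hf hb he)).
Qed.
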